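(* Let $c \in \mathcal{C}_{\mathrm{lin}}(\mathbb{R}^2)$ and let $\mu_1,\mu_3 \in \mathcal{P}(\mathbb{R})$ have finite first moments and satisfy $\mu_1\preceq\mu_3$ in convex order. Consider the set $$\mathcal{I}:= \Big\{\mu_2 \in \mathcal{P}(\mathbb{R})~\Big|~ \mu_1 \preceq \mu_2 \preceq \mu_3\text{ and } \inf_{\mathbb{Q} \in \mathcal{M}(\mu_1,\mu_2,\mu_3)}\mathbb{E}_{\mathbb{Q}}[c(S_{t_1},S_{t_3})]=\inf_{\mathbb{Q} \in \mathcal{M}(\mu_1,\mu_3)}\mathbb{E}_{\mathbb{Q}}[c(S_{t_1},S_{t_3})]\Big\}.$$ Then the following holds. (i) The set $\mathcal{I}$ is closed in the space $\{\mu_2 \in \mathcal{P}(\mathbb{R}) \mid \mu_1 \preceq \mu_2 \preceq \mu_3\}$ equipped with the topology induced by the Wasserstein distance of order $1$. (ii) The set $\mathcal{I}$ is convex.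
   Context: $\mathcal{P}(\mathbb{R}^d)$ is the set of Borel probability measures on $\mathbb{R}^d$. $\mathcal{C}_{\mathrm{lin}}(\mathbb{R}^d)$ is the set of continuous $c:\mathbb{R}^d\to\mathbb{R}$ with $\sup_{x\in\mathbb{R}^d}\frac{|c(x_1,\dots,x_d)|}{1+\sum_{i=1}^d|x_i|}<\infty$. Convex order: $\mu\preceq\nu$ if $\int f\,\mathrm{d}\mu\le\int f\,\mathrm{d}\nu$ for all convex $f:\mathbb{R}\to\mathbb{R}$ for which the integrals are finite. $(S_{t_1},S_{t_2},S_{t_3})$ denotes the canonical (coordinate) process on $\mathbb{R}^3$; for measures on $\mathbb{R}^2$ with marginals $(\mu_1,\mu_3)$ the coordinates are denoted $(S_{t_1},S_{t_3})$. $\mathcal{M}(\mu_1,\mu_2,\mu_3)\subset\mathcal{P}(\mathbb{R}^3)$ is the set of laws with one-dimensional marginals $\mu_1,\mu_2,\mu_3$ under which $(S_{t_1},S_{t_2},S_{t_3})$ is a martingale in its own filtration; $\mathcal{M}(\mu_1,\mu_3)\subset\mathcal{P}(\mathbb{R}^2)$ is the set of laws with marginals $\mu_1,\mu_3$ under which $(S_{t_1},S_{t_3})$ is a martingale. The Wasserstein distance of order 1 is $W_1(\mu,\nu)=\inf_{\mathbb{P}\in\Pi(\mu,\nu)}\int \|x-y\|\,\mathbb{P}(\mathrm{d}x,\mathrm{d}y)$, where $\Pi(\mu,\nu)$ is the set of joint distributions (couplings) of $\mu$ and $\nu$. *)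

(* Defs.v *)
From HB Require Import structures.
From mathcomp Require Import all_boot all_order all_algebra.
From mathcomp Require Import all_classical all_reals all_analysis.

Set Implicit Arguments.
Unset Strict Implicit.
Unset Printing Implicit Defensive.

Import Order.TTheory GRing.Theory Num.Theory.
Import numFieldNormedType.Exports.

Local Open Scope classical_set_scope.
Local Open Scope ring_scope.

Section Laws.
Context {R : realType}.

Definition finite_first_moment (mu : probability R R) : Prop :=
  (\int[mu]_x (`|x|%:E) < +oo)%E.

(* The integral of the library is total, so finiteness of the integral of [f]
   is expressed by integrability, with respect to both measures. *)
Definition convex_order (mu nu : probability R R) : Prop :=
  forall f : R -> R, convex_function (setT : set R) f ->
    mu.-integrable setT (EFin \o f) -> nu.-integrable setT (EFin \o f) ->
    (\int[mu]_x (f x)%:E <= \int[nu]_x (f x)%:E)%E.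

(* A measure may take arbitrary values on non-measurable sets; equality of laws
   is therefore tested on measurable sets only. *)
Definition has_law d (T : measurableType d) (Q : probability T R)
    (X : T -> R) (mu : probability R R) : Prop :=
  forall A : set R, measurable A -> pushforward Q X A = mu A.

Definition C_lin2 (c : R * R -> R) : Prop :=
  continuous c /\
  (ereal_sup (range (fun x : R * R =>
     (`|c x| / (1 + (`|x.1| + `|x.2|)))%:E)) < +oo)%E.

End Laws.

Section Martingales.
Context d (T : measurableType d) {R : realType} (Q : probability T R).

(* [Y] is a version of the conditional expectation of [X] given [G], where [X]
   is integrable and [G] is a sub-sigma-algebra of the measurable sets. *)
Definition is_cond_expectation (G : set (set T)) (X Y : T -> R) : Prop :=
  [/\ forall B : set R, measurable B -> G (Y @^-1` B),
      Q.-integrable setT (EFin \o Y) &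
      forall A, G A -> (\int[Q]_(w in A) (Y w)%:E = \int[Q]_(w in A) (X w)%:E)%E].

Definition natural_filtration n (X : 'I_n -> T -> R) (i : 'I_n) : set (set T) :=
  <<s \bigcup_(j in [set j : 'I_n | (j <= i)%N])
        preimage_set_system setT (X j) measurable >>.

Definition martingale n (X : 'I_n -> T -> R) : Prop :=
  (forall i, Q.-integrable setT (EFin \o X i)) /\
  forall i j : 'I_n, (i <= j)%N ->
    is_cond_expectation (natural_filtration X i) (X j) (X i).

End Martingales.

Section MartingaleTransport.
Context {R : realType}.
Implicit Types mu nu : probability R R.

Definition martingale_laws d (T : measurableType d) n (X : 'I_n -> T -> R)
    (mu : 'I_n -> probability R R) : set (probability T R) :=
  [set Q | (forall i, has_law Q (X i) (mu i)) /\ martingale Q X].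

Definition canonical2 : 'I_2 -> R * R -> R := tnth [tuple fst; snd].

Definition canonical3 : 'I_3 -> R * R * R -> R :=
  tnth [tuple (fun w => w.1.1); (fun w => w.1.2); (fun w => w.2)].

Definition M2 mu1 mu3 : set (probability (R * R)%type R) :=
  martingale_laws canonical2 (tnth [tuple mu1; mu3]).

Definition M3 mu1 mu2 mu3 : set (probability (R * R * R)%type R) :=
  martingale_laws canonical3 (tnth [tuple mu1; mu2; mu3]).

(* Over an empty set of laws, the infimum is +oo. *)
Definition lower_price2 (c : R * R -> R) mu1 mu3 : \bar R :=
  ereal_inf [set ('E_Q[c])%E | Q in M2 mu1 mu3].

Definition lower_price3 (c : R * R -> R) mu1 mu2 mu3 : \bar R :=
  ereal_inf [set ('E_Q[fun w : R * R * R => c (w.1.1, w.2)])%E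
            | Q in M3 mu1 mu2 mu3].

Definition set_I (c : R * R -> R) mu1 mu3 : set (probability R R) :=
  [set mu2 | [/\ convex_order mu1 mu2, convex_order mu2 mu3 &
    lower_price3 c mu1 mu2 mu3 = lower_price2 c mu1 mu3]].

End MartingaleTransport.

Section Wasserstein.
Context {R : realType}.
Implicit Types mu nu : probability R R.

Definition couplings mu nu : set (probability (R * R)%type R) :=
  [set P | has_law P fst mu /\ has_law P snd nu].

Definition W1 mu nu : \bar R :=
  ereal_inf [set (\int[P]_w (`|w.1 - w.2|%:E))%E | P in couplings mu nu].

Definition convex_interval mu1 mu3 :=
  {mu2 : probability R R | convex_order mu1 mu2 /\ convex_order mu2 mu3}.

End Wasserstein.

Section W1Topology.
Context {R : realType} (mu1 mu3 : probability R R).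
Local Notation X := (convex_interval mu1 mu3).

HB.instance Definition _ := gen_eqMixin X.
HB.instance Definition _ := gen_choiceMixin X.

Definition W1_open : set_system X :=
  [set U | forall m, U m -> exists2 e : R, 0 < e &
     forall m' : X, (W1 (sval m) (sval m') < e%:E)%E -> U m'].

Let W1_openT : W1_open setT.
Proof. by move=> m _; exists 1. Qed.

Let W1_openI : setI_closed W1_open.
Proof.
move=> U V oU oV m [/oU[e e0 eU] /oV[f f0 fV]].
exists (Num.min e f); first by rewrite lt_min e0.
move=> m'; rewrite EFin_min lt_min => /andP[em fm].
by split; [exact: eU | exact: fV].
Qed.

Let W1_open_bigU (J : Type) (U : J -> set X) :
  (forall j, W1_open (U j)) -> W1_open (\bigcup_j U j).
Proof.
move=> oU m [j _ /oU[e e0 eU]]; exists e => // m' /eU Um'.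
by exists j.
Qed.

(* The open sets are the sets containing a [W1]-ball around each of their
   points, i.e. the topology induced by the (extended) distance [W1]. *)
HB.instance Definition _ :=
  isOpenTopological.Build X W1_openT W1_openI W1_open_bigU.

End W1Topology.

Section Mixture.
Context {R : realType} (t : {i01 R}) (mu nu : probability R R).

Definition mixture : set R -> \bar R :=
  measure_add (mscale (t%:num)%:nng mu) (mscale (1 - t%:num)%:nng nu).

HB.instance Definition _ := Measure.on mixture.

Lemma mixtureE A :
  mixture A = ((t%:num)%:E * mu A + (1 - t%:num)%:E * nu A)%E.
Proof. by rewrite /mixture measure_addE. Qed.

Let mixture_setT : mixture setT = 1%E.
Proof. by rewrite mixtureE !probability_setT !mule1 -EFinD addrC subrK. Qed.

HB.instance Definition _ :=
  Measure_isProbability.Build _ _ _ mixture mixture_setT.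

End Mixture.

Definition convex_set_of_laws {R : realType} (I : set (probability R R)) : Prop :=
  forall (mu nu : probability R R) (t : {i01 R}),
    I mu -> I nu -> I (mixture t mu nu).

(* Main.v *)
(* Convexity: the martingale property and the expected cost are linear in the law,
   so a mixture of almost optimal laws for two intermediate marginals is almost
   optimal for the mixed marginal.

   Closedness: let the laws [Q n] be almost optimal for intermediate marginals
   tending to [m].  In place of Prokhorov's theorem, a subsequence is realized by
   almost surely convergent random vectors.  Compactify each coordinate to (0, 1);
   the unit cube is the image of [0, 1] under a continuous curve having a Borel
   section, so each [Q n] is the image under the curve of a quantile function.
   Quantile functions are monotone, hence by Helly's selection theorem a
   subsequence converges outside a countable set.  The marginals of the limit are
   identified by bounded Lipschitz test functions, so no mass escapes, and first
   moments converge along the subsequence; Fatou's lemma with a varying dominating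
   function of linear growth then gives lower semicontinuity of the cost and, used
   with both signs, the martingale property of the limit.  The latter is encoded by
   the vanishing of the expectations of an increment times [f U * g V] with
   Lipschitz [f] and [g]. *)
Require Import Defs.
From HB Require Import structures.
From mathcomp Require Import all_boot all_order all_algebra.
From mathcomp Require Import all_classical all_reals all_analysis.
From mathcomp Require Import measurable_realfun ring lra.

Set Implicit Arguments.
Unset Strict Implicit.
Unset Printing Implicit Defensive.

Import Order.TTheory GRing.Theory Num.Theory.
Import numFieldNormedType.Exports.

Local Open Scope classical_set_scope.
Local Open Scope ring_scope.

(** * A space-filling curve *)

(** Quantile functions exist only for real variables, which is why a triple is first encoded by a
    single number. The section of the curve is Borel but not continuous, so it only transports laws;
    limits pass through the continuous curve alone. A coordinate compactified to (0, 1) could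
    converge to an end point; this is excluded because its limit law turns out to be the image under
    [shrink] of a probability on the line. The cost is unbounded and the middle marginal moves, so
    no fixed dominating function is at hand. The integral of a sum of absolute values of the
    coordinates depends on the marginals alone, however, and it converges because the absolute value
    is Lipschitz. Both claims rest on one reformulation: erasing the middle coordinate maps [M3]
    into [M2], so equality of the prices says that for every real r strictly above the two-marginal
    price some law in [M3] costs at most r. For fixed r this survives limits and mixtures.
    Indicators of events are discontinuous and do not pass to the limit; Lipschitz tests do, and a
    Dynkin argument goes back to events. *)

Section GeometricSeries.
Context {R : realType} (r : R).
Hypotheses (r0 : 0 < r) (r1 : r < 1).
Implicit Types b : nat -> R.

(** Coefficients range over [0, 1] rather than {0, 1}, because the curve feeds in values of [ramp]
    at arbitrary points. The ratio is 1/2 for binary expansions and 1/3 for the Cantor set. *)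
Definition geom_sum b : R := limn (series (fun i => b i * r ^+ i)).

Let Er : `|r| < 1. Proof. by rewrite ger0_norm// ltW. Qed.

Let r1gt0 : 0 < 1 - r. Proof. by rewrite subr_gt0. Qed.

Let is_cvg_geom b : (forall i, 0 <= b i <= 1) ->
  cvgn (series (fun i => b i * r ^+ i)).
Proof.
move=> b01; apply: (@series_le_cvg R _ (geometric 1 r)).
- by move=> n; rewrite mulr_ge0 ?exprn_ge0 ?(ltW r0)//; case/andP: (b01 n).
- by move=> n; rewrite geometric_ge0// (ltW r0).
- by move=> n; rewrite /= ler_wpM2r ?exprn_ge0 ?(ltW r0)//; case/andP: (b01 n).
- exact: is_cvg_geometric_series.
Qed.

Lemma geom_sum_cvg b : (forall i, 0 <= b i <= 1) ->
  series (fun i => b i * r ^+ i) @ \oo --> geom_sum b.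
Proof. by move=> b01; exact: is_cvg_geom. Qed.

Lemma geom_sum_ge0 b : (forall i, 0 <= b i <= 1) -> 0 <= geom_sum b.
Proof.
move=> b01; apply: limr_ge; first exact: is_cvg_geom.
by apply: nearW => n; apply: sumr_ge0 => i _;
  rewrite mulr_ge0 ?exprn_ge0 ?(ltW r0)//; case/andP: (b01 i).
Qed.

Lemma geom_sum_le b : (forall i, 0 <= b i <= 1) -> geom_sum b <= (1 - r)^-1.
Proof.
move=> b01; rewrite -[leRHS]mul1r -(cvg_lim _ (@cvg_geometric_series R 1 _ Er))//.
apply: lim_series_le; [exact: is_cvg_geom|exact: is_cvg_geometric_series|].
by move=> n; rewrite /= ler_wpM2r ?exprn_ge0 ?(ltW r0)//; case/andP: (b01 n).
Qed.

Lemma geom_sumS b : (forall i, 0 <= b i <= 1) ->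
  geom_sum b = b 0%N + r * geom_sum (fun i => b i.+1).
Proof.
move=> b01; apply: cvg_lim => //; rewrite -cvg_shiftS.
have -> : (fun n => series (fun i => b i * r ^+ i) n.+1) =
   (fun n => b 0%N + r * series (fun i => b i.+1 * r ^+ i) n).
  apply/funext => n; rewrite /series/= big_nat_recl//= expr0 mulr1; congr (_ + _).
  by rewrite mulr_sumr; apply: eq_bigr => i _; rewrite exprS mulrCA.
apply: cvgD; first exact: cvg_cst.
apply: cvgM; first exact: cvg_cst.
by apply: geom_sum_cvg => i; exact: b01.
Qed.

Lemma geom_sum_split n b : (forall i, 0 <= b i <= 1) ->
  geom_sum b = series (fun i => b i * r ^+ i) n +
               r ^+ n * geom_sum (fun i => b (n + i)%N).
Proof.
elim: n b => [|n ih] b b01.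
  by rewrite seriesEord/= big_ord0 add0r expr0 mul1r.
rewrite geom_sumS// (ih (fun i => b i.+1))//.
rewrite mulrDr addrA mulrA -exprS; congr (_ + _ * _).
rewrite /series/= big_nat_recl//= expr0 mulr1; congr (_ + _).
by rewrite mulr_sumr; apply: eq_bigr => i _; rewrite exprS mulrCA.
Qed.

(** The tail after n terms is at most r^n / (1 - r) uniformly in t, so the sum is a uniform limit of
    continuous partial sums. *)
Lemma geom_sum_continuous (T : topologicalType) (f : nat -> T -> R) :
  (forall i, continuous (f i)) -> (forall i t, 0 <= f i t <= 1) ->
  continuous (fun t => geom_sum (f ^~ t)).
Proof.
move=> cf f01; have cser n : continuous (fun t => series (fun i => f i t * r ^+ i) n).
  rewrite /series/=; elim: n => [|n ih] t.
    by under eq_fun do rewrite big_geq//; exact: cvg_cst.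
  under eq_fun do rewrite big_nat_recr//=.
  by apply: cvgD; [exact: ih|apply: cvgM; [exact: cf|exact: cvg_cst]].
move=> t; apply/cvgrPdist_lt => e e0.
have [n ne] : exists n, r ^+ n * (1 - r)^-1 < e / 2.
  have /cvgrPdist_lt/(_ (e / 2)) := @cvg_geometric R (1 - r)^-1 _ Er.
  rewrite divr_gt0// => /(_ isT)[n _ /(_ n)]/= /(_ (leqnn n)).
  rewrite sub0r normrN ger0_norm; last by rewrite mulr_ge0 ?exprn_ge0 ?invr_ge0 ?(ltW r0) ?(ltW r1gt0).
  by move=> ?; exists n; rewrite mulrC.
have tail s : 0 <= r ^+ n * geom_sum (fun i => f (n + i)%N s) <= r ^+ n * (1 - r)^-1.
  by rewrite mulr_ge0 ?exprn_ge0 ?geom_sum_ge0 ?(ltW r0)//= ler_wpM2l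
    ?exprn_ge0 ?(ltW r0)// geom_sum_le.
have /cvgrPdist_lt/(_ (e / 2)) := cser n t.
rewrite divr_gt0// => /(_ isT); apply: filterS => s /=.
rewrite (geom_sum_split n (f01 ^~ t)) (geom_sum_split n (f01 ^~ s)).
(* Both tails lie in [0, z], so their difference costs z only once and e / 2 remains for the partial
   sums. *)
have aux (a c x y z : R) : 0 <= x <= z -> 0 <= y <= z -> z < e / 2 ->
    `|a - c| < e / 2 -> `|a + x - (c + y)| < e.
  move=> /andP[x0 xz] /andP[y0 yz] ze; rewrite !ltr_norml => /andP[? ?].
  by apply/andP; split; lra.
exact: aux (tail t) (tail s) ne.
Qed.

Lemma measurable_geom_sum d (T : measurableType d) (f : nat -> T -> R) :
  (forall i, measurable_fun setT (f i)) -> (forall i t, 0 <= f i t <= 1) ->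
  measurable_fun setT (fun t => geom_sum (f ^~ t)).
Proof.
move=> mf f01.
apply: (@measurable_fun_cvg _ _ _ _ (fun n t => series (fun i => f i t * r ^+ i) n)).
  move=> n; rewrite /series/=; apply: measurable_sum => i.
  by apply: measurable_funM.
by move=> t _; exact: geom_sum_cvg.
Qed.

End GeometricSeries.

Section BinaryDigits.
Context {R : realType}.
Implicit Types x t : R.

Definition bit x : R := (2^-1 <= x)%R%:R.
(** Subtracting the digit instead of taking a fractional part makes 1 a fixed point with all digits
    equal to 1, so the closed interval [0, 1] is invariant. *)
Definition doubling x : R := 2 * x - bit x.

Lemma bit01 x : 0 <= bit x <= 1.
Proof. by rewrite /bit ler0n lern1; case: (_ <= _). Qed.

Lemma doubling01 x : 0 <= x <= 1 -> 0 <= doubling x <= 1.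
Proof. by rewrite /doubling /bit; case: (leP 2^-1 x) => /= ? /andP[? ?]; apply/andP; split; lra. Qed.

Lemma bit_doubling x : x = 2^-1 * bit x + 2^-1 * doubling x.
Proof. rewrite /doubling; lra. Qed.

Lemma measurable_bit : measurable_fun setT bit.
Proof.
rewrite (_ : bit = \1_(`[2^-1, +oo[%classic)); first exact: measurable_indic.
by apply/funext => x; rewrite indicE /bit mem_setE in_itv/= andbT.
Qed.

Lemma measurable_doubling : measurable_fun setT doubling.
Proof.
apply: measurable_funB; last exact: measurable_bit.
exact: mulrl_measurable.
Qed.

Lemma iter_doubling01 n x : 0 <= x <= 1 -> 0 <= iter n doubling x <= 1.
Proof. by move=> x01; elim: n => //= n; exact: doubling01. Qed.

Lemma binary_expansion x : 0 <= x <= 1 ->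
  2^-1 * geom_sum 2^-1 (fun k => bit (iter k doubling x)) = x.
Proof.
move=> x01.
have h0 : (0 : R) < 2^-1 by rewrite invr_gt0.
have h1 : (2^-1 : R) < 1 by lra.
have b01 n i : 0 <= bit (iter (n + i) doubling x) <= 1 by exact: bit01.
have b0 i : 0 <= bit (iter i doubling x) <= 1 by exact: bit01.
(* After n digits the remainder is 2^-n times a point of the orbit of [doubling], which stays in
   [0, 1]. *)
have E n : x = 2^-1 * series (fun k => bit (iter k doubling x) * 2^-1 ^+ k) n
             + 2^-1 ^+ n * iter n doubling x.
  elim: n => [|n ih]; first by rewrite seriesEord/= big_ord0 mulr0 add0r mul1r.
  rewrite {1}ih {1}(bit_doubling (iter n doubling x)) seriesSr/= exprS.
  by move: (doubling _) (bit _) => a b; ring.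
apply/eqP; rewrite eq_sym -subr_eq0 -normr_le0; apply/ler_addgt0Pl => e e0; rewrite addr0.
have [n ne] : exists n, (2^-1 : R) ^+ n < e / 2.
  have h : `|2^-1 : R| < 1 by rewrite ger0_norm// ltW.
  have /cvgrPdist_lt/(_ (e / 2)) := @cvg_geometric R 1 _ h.
  rewrite divr_gt0// => /(_ isT)[n _ /(_ n)]/= /(_ (leqnn n)).
  rewrite sub0r normrN ger0_norm ?mul1r; last by rewrite exprn_ge0// ltW.
  by exists n.
rewrite {1}(E n) (geom_sum_split h0 h1 n b0).
have := geom_sum_le h0 h1 (b01 n); have := geom_sum_ge0 h0 h1 (b01 n).
have -> : (1 - 2^-1 : R)^-1 = 2 by field.
have := iter_doubling01 n x01; have : 0 <= (2^-1 : R) ^+ n by rewrite exprn_ge0// ltW.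
move: (series _ _) (geom_sum _ _) (iter _ _ _) (_ ^+ _) ne => a g z p pe p0 z01 g0 g2.
rewrite ler_norml; apply/andP; split; nra.
Qed.

End BinaryDigits.

(* A Schoenberg-type curve: [tripling] shifts the ternary expansion of a point of
   the Cantor set and [ramp] reads its leading digit, both continuously; digits
   are dealt out to the three coordinates in turn. *)
Section SpaceFillingCurve.
Context {R : realType}.
Implicit Types t : R.

Definition ramp t : R := Num.max 0 (Num.min 1 (3 * t - 1)).
Definition tripling t : R := 3 * t - 2 * ramp t.

Lemma ramp01 t : 0 <= ramp t <= 1.
Proof. by rewrite le_max lexx/= ge_max ler01/= ge_min lexx. Qed.

Lemma ramp_continuous : continuous ramp.
Proof.
move=> t; apply: (@continuous_max R R (cst 0) (fun t => Num.min 1 (3 * t - 1))).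
  exact: cvg_cst.
apply: (@continuous_min R R (cst 1) (fun t => 3 * t - 1)); first exact: cvg_cst.
by apply: cvgB; [apply: cvgM; [exact: cvg_cst|exact: cvg_id]|exact: cvg_cst].
Qed.

Lemma tripling_continuous : continuous tripling.
Proof.
move=> t; apply: cvgB; first by apply: cvgM; [exact: cvg_cst|exact: cvg_id].
by apply: cvgM; [exact: cvg_cst|exact: ramp_continuous].
Qed.

Lemma iter_tripling_continuous n : continuous (iter n tripling).
Proof.
elim: n => [|n ih] t; first exact: cvg_id.
by apply: (@cvg_comp _ _ _ (iter n tripling) tripling); [exact: ih|exact: tripling_continuous].
Qed.

(** The point whose ternary digits are 2 b_i; the leading 1/3 accounts for the first digit having
    weight 1/3. *)
Definition cantor_point (b : nat -> R) : R := 2 / 3 * geom_sum 3^-1 b.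

Lemma cantor_point01 (b : nat -> R) : (forall i, 0 <= b i <= 1) ->
  0 <= cantor_point b <= 1.
Proof.
move=> b01; rewrite /cantor_point.
have h0 : (0 : R) < 3^-1 by rewrite invr_gt0.
have h1 : (3^-1 : R) < 1 by lra.
have := geom_sum_le h0 h1 b01; have := geom_sum_ge0 h0 h1 b01.
have -> : (1 - 3^-1 : R)^-1 = 3 / 2 by field.
by move: (geom_sum _ _) => g ? ?; apply/andP; split; lra.
Qed.

(** The tail is at most 3/2, so the point lies in [0, 1/3] or in [2/3, 1] according to its first
    digit, and [ramp] is constant on each of these intervals. *)
Lemma ramp_tripling_cantor_point (b : nat -> R) :
  (forall i, b i = 0 \/ b i = 1) ->
  ramp (cantor_point b) = b 0%N /\
  tripling (cantor_point b) = cantor_point (fun i => b i.+1).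
Proof.
move=> b01.
have h0 : (0 : R) < 3^-1 by rewrite invr_gt0.
have h1 : (3^-1 : R) < 1 by lra.
have {}b01' i : 0 <= b i <= 1 by case: (b01 i) => ->; lra.
rewrite /tripling /cantor_point (geom_sumS h0 h1 b01').
have := geom_sum_le h0 h1 (fun i => b01' i.+1).
have := geom_sum_ge0 h0 h1 (fun i => b01' i.+1).
have -> : (1 - 3^-1 : R)^-1 = 3 / 2 by field.
move: (geom_sum _ _) => g g0 g1.
suff E : ramp (2 / 3 * (b 0%N + 3^-1 * g)) = b 0%N by split=> //; rewrite E; field.
rewrite /ramp; case: (b01 0%N) => ->.
  by apply/max_idPl; rewrite ge_min; apply/orP; right; lra.
by rewrite (min_idPl _) ?(max_idPr _)//; lra.
Qed.

Lemma ramp_iter_tripling (b : nat -> R) n : (forall i, b i = 0 \/ b i = 1) ->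
  ramp (iter n tripling (cantor_point b)) = b n.
Proof.
move=> b01.
suff -> : iter n tripling (cantor_point b) = cantor_point (fun i => b (n + i)%N).
  have [|-> _] := @ramp_tripling_cantor_point (fun i => b (n + i)%N); last by rewrite addn0.
  by move=> i.
elim: n => //= n ->.
have [i|_ ->] := @ramp_tripling_cantor_point (fun i => b (n + i)%N); first exact: b01.
by congr cantor_point; apply/funext => i; rewrite addnS.
Qed.

Definition curve_coord (j : nat) t : R :=
  2^-1 * geom_sum 2^-1 (fun k => ramp (iter (3 * k + j) tripling t)).

Lemma curve_coord_continuous j : continuous (curve_coord j).
Proof.
move=> t; apply: cvgM; first exact: cvg_cst.
apply: (@geom_sum_continuous R 2^-1 _ _ _ (fun k t => ramp (iter (3 * k + j) tripling t))).
- by rewrite invr_gt0.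
- lra.
- move=> k s; apply: (@cvg_comp _ _ _ (iter (3 * k + j) tripling) ramp).
    exact: iter_tripling_continuous.
  exact: ramp_continuous.
- by move=> k s; exact: ramp01.
Qed.

Definition curve t : R * R * R :=
  (curve_coord 0 t, curve_coord 1 t, curve_coord 2 t).

(** Total in j: every index from 2 on reads the third coordinate, so a bound for all j says no more
    than a bound for the three coordinates. *)
Definition coord3 (w : R * R * R) (j : nat) : R :=
  if j is j'.+1 then if j' is _.+1 then w.2 else w.1.2 else w.1.1.

(** Interleaves the binary digits of the three coordinates: position 3k + j holds digit k of
    coordinate j, where [curve_coord] reads it back. *)
Definition curve_section (w : R * R * R) : R :=
  cantor_point (fun i => bit (iter (i %/ 3) doubling (coord3 w (i %% 3)))).

Lemma curve_sectionK (w : R * R * R) :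
  (forall j, 0 <= coord3 w j <= 1) -> curve (curve_section w) = w.
Proof.
move=> w01.
have E j : (j < 3)%N -> curve_coord j (curve_section w) = coord3 w j.
  move=> j3; rewrite -[RHS]binary_expansion// /curve_coord; congr (_ * geom_sum _ _).
  apply/funext => k; rewrite /curve_section.
  pose b i := bit (iter (i %/ 3) doubling (coord3 w (i %% 3))).
  rewrite (@ramp_iter_tripling b); last first.
    by move=> i; rewrite /b /bit; case: (_ <= _); [right|left].
  by rewrite /b mulnC divnMDl// divn_small// addn0 modnMDl modn_small.
by rewrite /curve !E//; case: w {E w01} => -[].
Qed.

Lemma measurable_coord3 j : measurable_fun setT (coord3 ^~ j).
Proof.
have mfst : measurable_fun setT (fst : R * R * R -> R * R) by exact: measurable_fst.
case: j => [|[|j]] /=.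
- by apply: measurableT_comp; [exact: measurable_fst|exact: mfst].
- by apply: measurableT_comp; [exact: measurable_snd|exact: mfst].
- exact: measurable_snd.
Qed.

Lemma measurable_curve_section : measurable_fun setT curve_section.
Proof.
apply: measurable_funM; first exact: measurable_cst.
apply: (@measurable_geom_sum R 3^-1 _ _ _ _
  (fun i w => bit (iter (i %/ 3) doubling (coord3 w (i %% 3))))).
- by rewrite invr_gt0.
- lra.
- move=> i; apply: measurableT_comp; first exact: measurable_bit.
  elim: (i %/ 3)%N => [|n ih]; first exact: measurable_coord3.
  by apply: (measurableT_comp measurable_doubling ih).
- by move=> i w; exact: bit01.
Qed.

Lemma curve_continuous : continuous curve.
Proof.
move=> t; exact: (cvg_pair (cvg_pair (@curve_coord_continuous 0 t)
  (@curve_coord_continuous 1 t)) (@curve_coord_continuous 2 t)).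
Qed.

End SpaceFillingCurve.

(** * Quantile functions *)

Section RayLaws.
Context {R : realType}.

Lemma probability_eq_ray (P Q : probability R R) :
  (forall t : R, P `]-oo, t]%classic = Q `]-oo, t]%classic) ->
  forall A, measurable A -> P A = Q A.
Proof.
move=> PQ A mA.
apply: (@measure_unique _ R R (@RGenOInfty.G R) (fun k => `]- k%:R, +oo[%classic)) => //.
- exact: RGenOInfty.measurableE.
- move=> _ _ [x ->] [y ->]; exists (Num.max x y).
  by apply/seteqP; split => z /=; rewrite !in_itv/= !andbT gt_max => /andP.
- by move=> i; exists (- i%:R).
- apply/seteqP; split => // x _; exists (Num.bound x) => //=.
  by rewrite in_itv/= andbT ltrNl; exact: unstable.ltrNbound.
- move=> _ [x ->].
  suff : P `]x, +oo[%classic = Q `]x, +oo[%classic by [].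
  have E (S : probability R R) : (S `]x, +oo[%classic = 1 - S `]-oo, x]%classic)%E.
    by rewrite -probability_setC// setCitvl.
  by rewrite !E PQ.
- by move=> k; rewrite (le_lt_trans (probability_le1 _ _))// ltry.
Qed.

End RayLaws.

Section Quantile.
Local Open Scope ereal_scope.
Context {R : realType}.

Definition unif01 : probability (measurableTypeR R) R := uniform_prob (@ltr01 R).

Lemma unif01_ray (x : R) : (0 <= x <= 1)%R -> unif01 `]-oo, x]%classic = x%:E.
Proof.
move=> /andP[x0 x1]; rewrite /unif01/= /uniform_prob integral_uniform_pdf.
have -> : `]-oo, x]%classic `&` `[0%R, 1%R]%classic = `[0%R, x]%classic.
  apply/seteqP; split => u /=; rewrite !in_itv/=; first by move=> [-> /andP[->]].
  by move=> /andP[-> ux]; rewrite ux (le_trans ux).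
rewrite (eq_integral (cst 1)); last first.
  move=> u; rewrite inE/= in_itv/= => /andP[u0 ux].
  by rewrite /uniform_pdf u0 (le_trans ux)//= subr0 invr1.
rewrite integral_cst//= mul1e lebesgue_measure_itv/= lte_fin.
by move: x0; rewrite le_eqVlt => /predU1P[<-|->]; rewrite ?ltxx// oppr0 adde0.
Qed.

Lemma unif01_null (A : set R) : measurable A -> lebesgue_measure A = 0 -> unif01 A = 0.
Proof.
move=> mA A0; have /null_content_dominatesP := dominates_uniform_prob (@ltr01 R).
exact.
Qed.

Context d (T : measurableType d) (P : probability T R) (X : {RV P >-> R}).
Hypothesis X01 : forall w, (0 <= X w <= 1)%R.

Let F t := fine (cdf X t).

Let FE t : cdf X t = (F t)%:E.
Proof. by rewrite fineK// fin_num_measure. Qed.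

Let F01 t : (0 <= F t <= 1)%R.
Proof. by rewrite -!lee_fin -!FE cdf_ge0 cdf_le1. Qed.

(** The clause t = 1 keeps the set nonempty and the constraint on t bounds it below. The function is
    therefore monotone with values in [0, 1] on the whole line, as Helly's theorem below
    requires. *)
Definition quantile (u : R) : R :=
  inf [set t : R | t = 1%R \/ (0 <= t <= 1)%R /\ u%:E <= cdf X t].

Let S u := [set t : R | t = 1%R \/ (0 <= t <= 1)%R /\ u%:E <= cdf X t].

Let S_lb u : has_lbound (S u).
Proof. by exists 0%R => t [->|[/andP[]]]. Qed.

Lemma quantile01 u : (0 <= quantile u <= 1)%R.
Proof.
apply/andP; split; last by apply: (ge_inf (S_lb u)); left.
by apply: lb_le_inf; [exists 1%R; left|move=> t [->|[/andP[]]]].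
Qed.

Lemma quantile_nondecreasing : {homo quantile : u v / (u <= v)%R}.
Proof.
move=> u v uv; apply: lb_le_inf; first by exists 1%R; left.
move=> t [->|[t01 vF]]; apply: (ge_inf (S_lb u)); [by left|right; split=> //].
by apply: le_trans vF; rewrite lee_fin.
Qed.

(** The Galois connection between quantile and distribution functions. At t = 1 the left side holds
    for every u by definition, even for u > 1, hence the strict bound. *)
Lemma quantile_le u t : (0 <= t < 1)%R -> (quantile u <= t)%R = (u%:E <= cdf X t).
Proof.
move=> /andP[t0 t1]; apply/idP/idP; last first.
  by move=> uF; apply: (ge_inf (S_lb u)); right; rewrite t0 (ltW t1).
apply: contraTT; rewrite -!ltNge => Fu.
(* Right continuity of the distribution function leaves a gap to the right of t, and the infimum
   cannot enter it. *)
have [s [ts s1 Fs]] : exists s, [/\ (t < s)%R, (s < 1)%R & cdf X s < u%:E].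
  have /(_ (`]-oo, u%:E[%classic)) := @cdf_right_continuous _ _ _ P X t.
  have : nbhs (cdf X t) `]-oo, u%:E[%classic.
    by apply: open_nbhs_nbhs; split; [exact: open_ereal_lt_ereal|].
  move=> /[swap] /[apply] -[e /= e0 He].
  have h : (0 < Num.min (e / 2) ((1 - t) / 2))%R.
    by rewrite lt_min !divr_gt0// subr_gt0.
  exists (t + Num.min (e / 2) ((1 - t) / 2))%R; split.
  - by rewrite ltrDl.
  - have : (Num.min (e / 2) ((1 - t) / 2) <= (1 - t) / 2)%R by rewrite ge_min lexx orbT.
    move: h; lra.
  - have : (Num.min (e / 2) ((1 - t) / 2) <= e / 2)%R by rewrite ge_min lexx.
    move=> le2; have := He (t + Num.min (e / 2) ((1 - t) / 2))%R.
    rewrite /= in_itv/=; apply; last by rewrite ltrDl.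
    by rewrite opprD addrA subrr add0r normrN gtr0_norm//; lra.
apply: (lt_le_trans ts); apply: lb_le_inf; first by exists 1%R; left.
move=> r [->|[r01 ur]]; first exact: ltW.
rewrite leNgt; apply/negP => /ltW rs.
by have := le_lt_trans (le_trans ur (cdf_nondecreasing X rs)) Fs; rewrite ltxx.
Qed.

Lemma measurable_quantile :
  measurable_fun [set: measurableTypeR R] (quantile : measurableTypeR R -> R).
Proof. exact: nondecreasing_measurable quantile_nondecreasing. Qed.

(** It suffices to compare rays. For t in [0, 1) the preimage of a ray is a ray ending at F t, of
    uniform mass F t; for other t both sides are 0 or 1 because [X] and [quantile] take values in
    [0, 1]. *)
Lemma quantile_law A : measurable A ->
  pushforward unif01 quantile A = P (X @^-1` A).
Proof.
pose q : {mfun (measurableTypeR R) >-> R} :=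
  
  HB.pack (quantile : measurableTypeR R -> R)
    (isMeasurableFun.Build _ _ (measurableTypeR R) R quantile measurable_quantile).
move=> mA.
suff : forall A, measurable A -> distribution unif01 q A = distribution P X A by exact.
apply: probability_eq_ray => t.
rewrite -/(cdf X t) /distribution /pushforward/=.
have [t0|t0] := ltP t 0%R.
  rewrite (_ : _ @^-1` _ = set0) ?measure0; last first.
    apply/seteqP; split => u //=; rewrite in_itv/= => qt.
    by have /andP[+ _] := quantile01 u; rewrite leNgt (le_lt_trans qt).
  apply/esym; rewrite /cdf /distribution /pushforward (_ : _ @^-1` _ = set0) ?measure0//.
  apply/seteqP; split => u //=; rewrite in_itv/= => qt.
  by have /andP[+ _] := X01 u; rewrite leNgt (le_lt_trans qt).
have [t1|t1] := ltP t 1%R.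
  rewrite (_ : _ @^-1` _ = `]-oo, F t]%classic); last first.
    apply/seteqP; split => u /=; rewrite !in_itv/= quantile_le ?t0// FE lee_fin//.
  by rewrite -[RHS]/(cdf X t) FE; exact: (unif01_ray (F01 t)).
rewrite (_ : _ @^-1` _ = setT); last first.
  apply/seteqP; split => u //= _; rewrite in_itv/=.
  by have /andP[_ /le_trans] := quantile01 u; apply.
rewrite probability_setT; apply/esym.
rewrite /cdf /distribution /pushforward (_ : _ @^-1` _ = setT) ?probability_setT//.
apply/seteqP; split => u //= _; rewrite in_itv/=.
by have /andP[_ /le_trans] := X01 u; apply.
Qed.

End Quantile.

(** * Helly's selection theorem *)

Section Helly.
Context {R : realType}.

(** Tychonoff's theorem on the product of copies of [0, 1] indexed by the line. A neighbourhood in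
    the product topology controls only finitely many coordinates, hence the finite list s. *)
Lemma pointwise_cluster (q : nat -> R -> R) :
  (forall n u, 0 <= q n u <= 1) ->
  exists p : R -> R, (forall u, 0 <= p u <= 1) /\
    forall (s : seq R) (e : R) (N : nat), 0 < e ->
      exists2 m, (N <= m)%N & forall x, x \in s -> `|q m x - p x| < e.
Proof.
move=> q01.
pose K : R -> topologicalType := fun=> R.
have [] := @tychonoff R K (fun=> `[0, 1]%classic) (fun=> @segment_compact R 0 1)
  (q @ \oo) _.
  by exists 0%N => // n _ u /=; rewrite in_itv/=.
move=> p [p01 clp]; exists p; split.
  by move=> u; have := p01 u; rewrite /= in_itv.
move=> s e N e0.
have B : nbhs p [set f : forall i, K i | forall x, x \in s -> `|f x - p x| < e].
  elim: s => [|a s ih]; first by apply: filterS filterT => f _ x.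
  have na : nbhs (p a : R) [set y : R | `|y - p a| < e].
    by exists e => //= y /=; rewrite distrC.
  have := @proj_continuous R K a p _ na.
  by apply: filterS2 ih => f fs fa x; rewrite inE => /predU1P[->//|]; exact: fs.
have [|f [/= [m Nm <-] fs]] := clp [set f : forall i, K i | exists2 m, (N <= m)%N & q m = f] _ _ B.
  by exists N => // m /= Nm; exists m.
by exists m.
Qed.

Lemma nondecreasing_squeeze_rat (p : R -> R) (u e : R) :
  {homo p : x y / x <= y} -> ~ discontinuity p u -> 0 < e ->
  exists a b : rat, [/\ ratr a < u, u < ratr b, p u - p (ratr a) < e &
    p (ratr b) - p u < e].
Proof.
move=> np dp e0.
have cl : cvg (p x @[x --> u^'-]).
  apply: nondecreasing_at_left_is_cvgr; near=> r.
    by move=> x y _ _; exact: np.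
  exists (p u) => _/= [z + <-]; rewrite in_itv/= => /andP[_ /ltW]; exact: np.
have cr : cvg (p x @[x --> u^'+]).
  apply: nondecreasing_at_right_is_cvgr; near=> r.
    by move=> x y _ _; exact: np.
  exists (p u) => _/= [z + <-]; rewrite in_itv/= => /andP[/ltW + _]; exact: np.
have E : lim (p x @[x --> u^'-]) = lim (p x @[x --> u^'+]).
  by apply/eqP; apply: contra_notT dp => ?; split.
have e20 : 0 < e / 2 by rewrite divr_gt0.
have /cvgrPdist_lt/(_ _ e20)[d1 /= d10 H1] := cl.
have /cvgrPdist_lt/(_ _ e20)[d2 /= d20 H2] := cr.
have [a] := @rat_in_itvoo R (u - d1) u (ltac:(by rewrite ltrBlDr ltrDl)).
have [b] := @rat_in_itvoo R u (u + d2) (ltac:(by rewrite ltrDl)).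
rewrite !in_itv/= => /andP[ub bu] /andP[ua au].
exists a, b.
have ha : ball_ Num.norm u d1 (ratr a).
  by rewrite /ball_/= ltr_norml; apply/andP; split; lra.
have hb : ball_ Num.norm u d2 (ratr b).
  by rewrite /ball_/= ltr_norml; apply/andP; split; lra.
(* The values at a and b lie within e / 2 of the common one-sided limit, and monotonicity puts p u
   between them. *)
move: (H1 _ ha au) (H2 _ hb ub); rewrite -E !ltr_norml => /andP[? ?] /andP[? ?].
have := np _ _ (ltW ub); have := np _ _ (ltW au).
by split => //; lra.
Unshelve. all: by end_near. Qed.

(** Convergence on the rationals and monotonicity force convergence wherever p is continuous. The
    bound n <= k n is the only trace of extraction kept; it is enough to preserve rates that
    decrease in n. *)
Lemma helly_selection (q : nat -> R -> R) :
  (forall n, {homo q n : x y / x <= y}) ->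
  (forall n u, 0 <= q n u <= 1) ->
  exists (k : nat -> nat) (p : R -> R),
   [/\ forall n, (n <= k n)%N, {homo p : x y / x <= y} &
     countable [set u | ~ (q (k n) u @[n --> \oo] --> p u)]].
Proof.
move=> nq q01; have [p [p01 clp]] := pointwise_cluster q01.
have np : {homo p : x y / x <= y}.
  move=> x y xy; rewrite leNgt; apply/negP => pyx.
  have e0 : 0 < (p x - p y) / 2 by rewrite divr_gt0// subr_gt0.
  have [m _ H] := clp [:: x; y] _ 0%N e0.
  have := H x; have := H y; rewrite !inE !eqxx orbT => /(_ isT) + /(_ isT).
  have := nq m _ _ xy; rewrite !ltr_norml => ? /andP[? ?] /andP[? ?]; lra.
(* The rationals with code below n: every rational belongs to all but finitely many of these lists,
   which replaces a diagonal extraction. *)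
pose s n : seq R := [seq ratr r | r <- pmap unpickle (iota 0 n)].
have /choice[k Hk] : forall n, exists m, (n <= m)%N /\
    forall x, x \in s n -> `|q m x - p x| < n.+1%:R^-1.
  move=> n; have [|m nm H] := clp (s n) n.+1%:R^-1 n; last by exists m.
  by rewrite invr_gt0.
exists k, p; split=> //; first by move=> n; case: (Hk n).
have cvg_rat (r : rat) : q (k n) (ratr r) @[n --> \oo] --> p (ratr r).
  apply/cvgrPdist_lt => e e0; near=> n.
  rewrite distrC; apply: lt_trans ((Hk n).2 _ _) _.
    apply: map_f; rewrite mem_pmap; apply/mapP; exists (pickle r); last by rewrite pickleK.
    by rewrite mem_iota add0n; near: n; exact: nbhs_infty_gt.
  by near: n; exact: near_infty_natSinv_lt (PosNum e0).
pose l (n : nat) : R := - n%:R; pose r (n : nat) : R := n%:R.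
pose D n := [set x | x \in (`]l n, r n[) /\ discontinuity p x].
apply: (@sub_countable _ _ _ (\bigcup_n D n)).
  apply: subset_card_le => u ncv.
  have du : discontinuity p u.
    apply: contrapT => ndu; apply: ncv; apply/cvgrPdist_lt => e e0.
    have e20 : 0 < e / 2 by rewrite divr_gt0.
    have [a [b [au ub pa pb]]] := nondecreasing_squeeze_rat np ndu e20.
    have /cvgrPdist_lt/(_ _ e20) := cvg_rat a.
    have /cvgrPdist_lt/(_ _ e20) := cvg_rat b.
    apply: filterS2 => n; rewrite !ltr_norml => /andP[? ?] /andP[? ?].
    have := nq (k n) _ _ (ltW au); have := nq (k n) _ _ (ltW ub).
    by move=> ? ?; apply/andP; split; lra.
  exists (Num.bound u) => //=; split=> //; rewrite in_itv/= -ltr_norml.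
  exact: unstable.ltr_norm_bound.
apply: bigcup_countable => // n _; apply: discontinuity_countable.
by move=> x y _ _; exact: np.
Unshelve. all: by end_near. Qed.

End Helly.

(** * Almost surely convergent representation of a subsequence *)

Section SkorokhodRepresentation.
Context {R : realType}.
Local Notation U := (measurableTypeR R).

Lemma measurable_curve : measurable_fun [set: R] (@curve R).
Proof.
have mc j : measurable_fun [set: R] (@curve_coord R j).
  by apply: continuous_measurable_fun; exact: curve_coord_continuous.
apply: measurable_fun_pair; last exact: mc.
by apply: measurable_fun_pair; exact: mc.
Qed.

Lemma skorokhod_subsequence d (T : measurableType d) (h : T -> R * R * R)
    (Q : nat -> probability T R) :
  measurable_fun setT h -> (forall w j, 0 <= coord3 (h w) j <= 1) ->
  exists (k : nat -> nat) (A : nat -> U -> R * R * R) (A' : U -> R * R * R),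
  [/\ forall n, (n <= k n)%N, forall n, measurable_fun setT (A n),
      measurable_fun setT A',
      forall n B, measurable B -> unif01 (A n @^-1` B) = Q (k n) (h @^-1` B) &
      {ae unif01, forall u, A n u @[n --> \oo] --> A' u}].
Proof.
move=> mh h01.
have mX : measurable_fun setT (curve_section \o h).
  by apply: measurableT_comp mh; exact: measurable_curve_section.
pose X : {mfun T >-> R} :=
  HB.pack (curve_section \o h) (isMeasurableFun.Build _ _ _ _ _ mX).
have X01 w : 0 <= X w <= 1 by apply: cantor_point01 => i; exact: bit01.
have [k [q [kn nq cq]]] := helly_selection
  (fun n => @quantile_nondecreasing R _ _ (Q n) X)
  (fun n => @quantile01 R _ _ (Q n) X).
exists k, (fun n => curve \o (quantile (P := Q (k n)) X)), (curve \o q); split => //.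
- move=> n.
  exact: (measurableT_comp measurable_curve (measurable_quantile (P := Q (k n)) X)).
- have mq : measurable_fun [set: U] (q : U -> R).
    exact: (@nondecreasing_measurable R setT q).
  exact: (measurableT_comp measurable_curve mq).
- move=> n B mB.
  have mcB : measurable (curve @^-1` B).
    by rewrite -[X in measurable X]setTI; exact: measurable_curve.
  have := quantile_law (P := Q (k n)) (X := X) X01 mcB.
  rewrite /pushforward => E; rewrite comp_preimage; apply: (etrans E).
  (* Since [h] takes values in the cube, the curve undoes the encoding exactly. *)
  congr (Q (k n) _); apply/seteqP; split => w /=; rewrite curve_sectionK//.
exists [set u | ~ (quantile (P := Q (k n)) X u @[n --> \oo] --> q u)]; split.
- by apply: countable_measurable => // t; exact: measurable_set1.
(* The countable exceptional set of Helly's theorem is Lebesgue null, hence null for the uniform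
   law. *)
- apply: unif01_null; last exact: countable_lebesgue_measure0.
  by apply: countable_measurable => // t; exact: measurable_set1.
- move=> u /= ncv cv; apply: ncv => /=.
  by apply: (cvg_comp _ _ cv); exact: curve_continuous.
Qed.

End SkorokhodRepresentation.

(** * Limits of laws and of integrals *)

Section IntegralOfLaw.
Local Open Scope ereal_scope.
Context d d' dS (T : measurableType d) (T' : measurableType d')
  (S : measurableType dS) (R : realType).
Variables (P : probability T R) (P' : probability T' R).
Variables (X : T -> S) (X' : T' -> S).
Hypotheses (mX : measurable_fun setT X) (mX' : measurable_fun setT X').
Hypothesis XX' : forall B, measurable B -> P (X @^-1` B) = P' (X' @^-1` B).

Lemma ge0_integral_law (f : S -> \bar R) : measurable_fun setT f ->
  (forall s, 0 <= f s) -> \int[P]_w f (X w) = \int[P']_w f (X' w).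
Proof.
move=> mf f0.
pose mX1 : {mfun T >-> S} := HB.pack X (isMeasurableFun.Build _ _ _ _ _ mX).
pose mX2 : {mfun T' >-> S} := HB.pack X' (isMeasurableFun.Build _ _ _ _ _ mX').
have := @ge0_integral_distribution _ _ _ _ _ P mX1 f mf f0.
have := @ge0_integral_distribution _ _ _ _ _ P' mX2 f mf f0.
rewrite /comp/= => <- <-; apply: eq_measure_integral => A mA _.
exact: XX'.
Qed.

Lemma integral_law (f : S -> \bar R) : measurable_fun setT f ->
  \int[P]_w f (X w) = \int[P']_w f (X' w).
Proof.
move=> mf.
have Ep : \int[P]_w (f^\+ \o X) w = \int[P']_w (f^\+ \o X') w.
  by apply: ge0_integral_law => //; exact: measurable_funepos.
have En : \int[P]_w (f^\- \o X) w = \int[P']_w (f^\- \o X') w.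
  by apply: ge0_integral_law => //; exact: measurable_funeneg.
have := integralE P setT (f \o X); have := integralE P' setT (f \o X').
by rewrite (funepos_comp f X) (funepos_comp f X') (funeneg_comp f X)
  (funeneg_comp f X') Ep En => <-.
Qed.

Lemma integrable_law (f : S -> \bar R) : measurable_fun setT f ->
  P.-integrable setT (f \o X) -> P'.-integrable setT (f \o X').
Proof.
move=> mf /integrableP[_ fX]; apply/integrableP; split.
  exact: measurableT_comp.
rewrite -(@ge0_integral_law (abse \o f))//.
  exact: measurableT_comp.
by move=> s /=; exact: abse_ge0.
Qed.

End IntegralOfLaw.

Section FatouPratt.
Local Open Scope ereal_scope.
Context d (T : measurableType d) (R : realType) (P : probability T R).

Lemma limn_einf_le (u v : (\bar R)^nat) : (forall n, u n <= v n) ->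
  limn_einf u <= limn_einf v.
Proof.
move=> uv; rewrite !limn_einf_lim; apply: lee_lim; [exact: is_cvg_einfs..|].
apply: nearW => n; apply: le_ereal_inf_tmp => _ [m /= nm <-].
by apply: le_trans (uv m); apply: ereal_inf_lbound; exists m.
Qed.

(* Fatou's lemma applied to [F_ n + G_ n >= 0]; the dominating functions vary. *)
Lemma fatou_pratt (F_ G_ : nat -> T -> R) (F G : T -> R) (r : R) :
  (forall n, measurable_fun setT (F_ n)) -> measurable_fun setT F ->
  (forall n, P.-integrable setT (EFin \o G_ n)) ->
  P.-integrable setT (EFin \o G) ->
  (forall n w, `|F_ n w| <= G_ n w)%R -> (forall w, `|F w| <= G w)%R ->
  {ae P, forall w, F_ n w @[n --> \oo] --> F w} ->
  {ae P, forall w, G_ n w @[n --> \oo] --> G w} ->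
  \int[P]_w (G_ n w)%:E @[n --> \oo] --> \int[P]_w (G w)%:E ->
  (forall n, \int[P]_w (F_ n w)%:E <= r%:E) ->
  \int[P]_w (F w)%:E <= r%:E.
Proof.
move=> mF_ mF iG_ iG FG_ FG cF cG cI Fr.
have iF_ n : P.-integrable setT (EFin \o F_ n).
  apply: (le_integrable _ _ _ (iG_ n)) => //; first exact/measurable_EFinP.
  move=> w _; rewrite /= lee_fin (le_trans (FG_ n w))//; exact: ler_norm.
have iF : P.-integrable setT (EFin \o F).
  apply: (le_integrable _ _ _ iG) => //; first exact/measurable_EFinP.
  move=> w _; rewrite /= lee_fin (le_trans (FG w))//; exact: ler_norm.
have mG_ n : measurable_fun setT (G_ n).
  by apply/measurable_EFinP; exact: measurable_int (iG_ n).
have mG : measurable_fun setT G.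
  by apply/measurable_EFinP; exact: measurable_int iG.
pose H n w := (F_ n w + G_ n w)%:E.
have mH n : measurable_fun setT (H n).
  by apply/measurable_EFinP; exact: measurable_funD.
have H0 n w : setT w -> 0 <= H n w.
  move=> _; rewrite lee_fin; have := FG_ n w; rewrite ler_norml => /andP[? ?]; lra.
have := fatou P measurableT mH H0.
have -> : \int[P]_w limn_einf (H ^~ w) = \int[P]_w ((F w)%:E + (G w)%:E).
  apply: ae_eq_integral => //.
  - rewrite /limn_einf; apply: measurableT_comp => //.
    by apply: measurable_fun_limn_esup => n; exact: measurableT_comp.
  - by apply: emeasurable_funD; exact/measurable_EFinP.
  - apply: filterS2 cF cG => w cF cG _.
    have [-> _] // : limn_einf (H ^~ w) = (F w)%:E + (G w)%:E /\ True.
    split => //; apply: (cvg_limn_einf_sup _).1.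
    by rewrite -EFinD; apply: cvg_EFin; [exact: nearW|exact: cvgD].
rewrite integralD// => le1.
(* The integrals of [G_ n] converge, so they add exactly the integral of [G], which is finite and
   cancels at the end. *)
have le2 : limn_einf (fun n => \int[P]_w H n w) <= r%:E + \int[P]_w (G w)%:E.
  rewrite (le_trans (limn_einf_le (v := fun n => r%:E + \int[P]_w (G_ n w)%:E) _))//.
    move=> n; have -> : \int[P]_w H n w = \int[P]_w (F_ n w)%:E + \int[P]_w (G_ n w)%:E.
      exact: (integralD measurableT (iF_ n) (iG_ n)).
    by rewrite leeD2r.
  by rewrite limn_einf_shift//; rewrite (cvg_limn_einf_sup cI).1.
have fG : \int[P]_w (G w)%:E \is a fin_num by exact: integrable_fin_num.
by have := le_trans le1 le2; rewrite leeD2rE.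
Qed.

End FatouPratt.

(** * Lipschitz test functions *)

Section LipschitzTests.
Context {R : realType}.

(** Values in [0, 1] make the class stable under products, provide the dominating constant 1, and
    allow the digit expansion of [orthogonal_mul01]. *)
Definition lip_test (f : R -> R) : Prop :=
  (forall x, 0 <= f x <= 1) /\
  exists2 k : R, 0 <= k & forall x y, `|f x - f y| <= k * `|x - y|.

Lemma lip_test_continuous f : lip_test f -> continuous f.
Proof.
move=> [_ [k k0 fk]] x; apply/cvgrPdist_lt => e e0.
have k1 : 0 < k + 1 by rewrite ltr_wpDl.
near=> y.
apply: (le_lt_trans (fk _ _)); rewrite (@le_lt_trans _ _ ((k + 1) * `|x - y|))//.
  by rewrite ler_wpM2r// lerDl.
rewrite mulrC -ltr_pdivlMr//; near: y.
by exists (e / (k + 1)) => //=; exact: divr_gt0.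
Unshelve. all: by end_near. Qed.

Lemma measurable_lip_test f : lip_test f -> measurable_fun setT f.
Proof. by move=> /lip_test_continuous; exact: continuous_measurable_fun. Qed.

Lemma lip_test_cst1 : lip_test (cst 1).
Proof.
split=> [x|]; first by rewrite ler01 lexx.
by exists 0 => // x y; rewrite subrr normr0 mul0r.
Qed.

Lemma lip_testM f g : lip_test f -> lip_test g -> lip_test (fun x => f x * g x).
Proof.
move=> [f01 [k k0 fk]] [g01 [l l0 gl]]; split.
  by move=> x; have /andP[? ?] := f01 x; have /andP[? ?] := g01 x;
    rewrite mulr_ge0//= mulr_ile1.
exists (k + l); first exact: addr_ge0.
move=> x y; have -> : f x * g x - f y * g y = (f x - f y) * g x + f y * (g x - g y) by ring.
rewrite (le_trans (ler_normD _ _))// [leRHS]mulrDl !normrM.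
have /andP[? ?] := f01 y; have /andP[? ?] := g01 x.
apply: lerD; first by rewrite -[leRHS]mulr1 ler_pM// ger0_norm.
by rewrite -[leRHS]mul1r ler_pM// ger0_norm.
Qed.

Lemma lip_test_comp f h : lip_test f -> (forall x y, `|h x - h y| <= `|x - y|) ->
  lip_test (f \o h).
Proof.
move=> [f01 [k k0 fk]] h1; split=> [x|]; first exact: f01.
by exists k => // x y; apply: (le_trans (fk _ _)); rewrite ler_wpM2l.
Qed.

(** Pointwise approximation suffices, as the tests are bounded by 1 and dominated convergence
    applies. Stability under intersection yields a pi-system. *)
Definition approximable (B : set R) : Prop := exists f : nat -> R -> R,
  (forall n, lip_test (f n)) /\ forall x, f n x @[n --> \oo] --> (\1_B x : R).

Lemma approximableT : approximable setT.
Proof.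
exists (fun=> cst 1); split=> [n|x]; first exact: lip_test_cst1.
by rewrite indicT; exact: cvg_cst.
Qed.

Lemma approximableI B C : approximable B -> approximable C -> approximable (B `&` C).
Proof.
move=> [f [tf cf]] [g [tg cg]]; exists (fun n x => f n x * g n x); split.
  by move=> n; exact: lip_testM.
by move=> x; rewrite indicI; exact: cvgM.
Qed.

Lemma approximable_ray (t : R) : approximable `]t, +oo[.
Proof.
exists (fun n x => Num.max 0 (Num.min 1 (n%:R * (x - t)))); split.
  move=> n; split=> [x|].
    by rewrite le_max lexx/= ge_max ler01/= ge_min lexx.
  exists n%:R => // x y.
  have -> : n%:R * `|x - y| = `|n%:R * (x - t) - n%:R * (y - t)|.
    by rewrite -mulrBr normrM ger0_norm//; congr (_ * `|_|); ring.
  (* It remains that clamping to [0, 1] does not increase distances, checked over the branches of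
     max and min. *)
  move: (_ * _) (_ * _) => a b.
  have := ler_norm (a - b); have := ler_norm (b - a); rewrite (distrC b a) => h1 h2.
  rewrite ler_norml; apply/andP; split;
   rewrite /Num.max /Num.min; repeat case: ifP => //;
   move=> *; rewrite ?ltNge in h1 h2 *; do ?[match goal with H : (_ < _) = false |- _ => move/negbT: H; rewrite -leNgt => H end]; lra.
move=> x; rewrite indicE mem_setE in_itv/= andbT.
have [tx|xt] := ltP t x; last first.
  apply: cvg_near_cst; apply: nearW => n; apply/max_idPl.
  by rewrite ge_min mulr_ge0_le0 ?subr_le0 ?orbT.
apply: cvg_near_cst; near=> n.
have h : 1 <= n%:R * (x - t).
  rewrite -ler_pdivrMr ?subr_gt0// mul1r.
  by near: n; exact: nbhs_infty_ger.
by rewrite (min_idPl _)// (max_idPr _).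
Unshelve. all: by end_near. Qed.

End LipschitzTests.

Section WeakUniqueness.
Local Open Scope ereal_scope.
Context {R : realType}.

Lemma lip_test_unique (P Q : probability R R) :
  (forall f, lip_test f -> \int[P]_x (f x)%:E = \int[Q]_x (f x)%:E) ->
  forall A, measurable A -> P A = Q A.
Proof.
move=> PQ.
have E (S : probability R R) (f : nat -> R -> R) (B : set R) : measurable B ->
    (forall n, lip_test (f n)) -> (forall x, f n x @[n --> \oo] --> (\1_B x : R)) ->
    \int[S]_x (f n x)%:E @[n --> \oo] --> S B.
  move=> mB tf cf.
  rewrite -(setIT B) -integral_indic//.
  have h1 n : measurable_fun setT (fun x => (f n x)%:E).
    by apply/measurable_EFinP; exact: measurable_lip_test.
  have h2 : measurable_fun setT (fun x => (\1_B x : R)%:E).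
    by apply/measurable_EFinP; exact: measurable_indic.
  have h3 : {ae S, forall x, setT x -> (f n x)%:E @[n --> \oo] --> (\1_B x : R)%:E}.
    by apply: aeW => x _; apply: cvg_EFin; [exact: nearW|exact: cf].
  have h4 : S.-integrable setT (cst 1%E).
    exact: (finite_measure_integrable_cst S 1 measurableT).
  have h5 : {ae S, forall x n, setT x -> `|(f n x)%:E| <= cst 1%E x}.
    apply: aeW => x n _; rewrite /= lee_fin.
    by have [/(_ x)/andP[? ?] _] := tf n; rewrite ger0_norm.
  by have [] := dominated_convergence measurableT h1 h2 h3 h4 h5.
apply: probability_eq_ray => t.
have [f [tf cf]] := approximable_ray t.
have mt : measurable (`]t, +oo[%classic : set R) by exact: measurable_itv.
have := E P f _ mt tf cf; have := E Q f _ mt tf cf.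
under eq_fun do rewrite -PQ//.
move=> /cvg_unique H1 /H1 /= /(_ (@ereal_hausdorff _)).
rewrite -setCitvl !probability_setC// => H2.
apply/esym; move: H2.
have: P `]-oo, t]%classic \is a fin_num by rewrite fin_num_measure.
have: Q `]-oo, t]%classic \is a fin_num by rewrite fin_num_measure.
by move: (P _) (Q _) => [p| |] [q| |]// _ _ [] h; congr (_%:E); lra.
Qed.

End WeakUniqueness.

(** * Compactification of the line *)

Section Shrink.
Context {R : realType}.
Implicit Types x y s : R.

(** A homeomorphism onto (0, 1) that does not increase distances, so that a Lipschitz test composed
    with it is again a Lipschitz test. *)
Definition shrink x : R := 2^-1 * (1 + x / (1 + `|x|)).

(** Extended by 0 outside (0, 1) to be total and Borel. Continuity fails at the end points, which is
    why limits must be shown to avoid them. *)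
Definition unshrink : R -> R :=
  (fun s => (2 * s - 1) / (1 - `|2 * s - 1|)) \_ `]0, 1[%classic.

Let den0 x : 0 < 1 + `|x|. Proof. by rewrite ltr_wpDr. Qed.

Lemma shrink_itv x : 0 < shrink x < 1.
Proof.
have : `|x / (1 + `|x|)| < 1.
  by rewrite normrM normfV (ger0_norm (ltW (den0 x))) ltr_pdivrMr// mul1r ltrDr.
by rewrite /shrink ltr_norml => /andP[? ?]; apply/andP; split; lra.
Qed.

Lemma shrinkK : cancel shrink unshrink.
Proof.
move=> x; rewrite /unshrink patchE ifT; last by rewrite inE/= in_itv/= shrink_itv.
have -> : 2 * shrink x - 1 = x / (1 + `|x|) by rewrite /shrink; field.
rewrite normrM normfV (ger0_norm (ltW (den0 x))).
have := den0 x; move: `|x| => a a0; field; rewrite ?gt_eqF//=.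
by rewrite addrK ltr01.
Qed.

Lemma shrink_lip x y : `|shrink x - shrink y| <= `|x - y|.
Proof.
have dx := den0 x; have dy := den0 y.
have -> : shrink x - shrink y =
    2^-1 * ((x * (1 + `|y|) - y * (1 + `|x|)) / ((1 + `|x|) * (1 + `|y|))).
  by rewrite /shrink; field; rewrite !gt_eqF.
rewrite normrM ger0_norm ?invr_ge0// normrM normfV.
rewrite (ger0_norm (ltW (mulr_gt0 dx dy))) mulrA ler_pdivrMr ?mulr_gt0//.
have -> : x * (1 + `|y|) - y * (1 + `|x|) = (x - y) * (1 + `|y|) + y * (`|y| - `|x|) by ring.
rewrite (le_trans (y := 2^-1 * (`|x - y| * (1 + `|y|) + `|y| * `|x - y|)))//.
  rewrite ler_wpM2l ?invr_ge0// (le_trans (ler_normD _ _))// !normrM.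
  rewrite (ger0_norm (ltW dy)) lerD2l ler_wpM2l// (distrC x).
  exact: ler_dist_dist.
have := normr_ge0 x; have := normr_ge0 y; have := normr_ge0 (x - y).
move: `|x| `|y| `|x - y| => a b e e0 b0 a0; rewrite -subr_ge0.
rewrite (_ : _ - _ = e * (2^-1 + a + a * b)); last by field.
by rewrite mulr_ge0// !addr_ge0// ?mulr_ge0 ?invr_ge0.
Qed.

Lemma measurable_shrink : measurable_fun setT shrink.
Proof.
apply: continuous_measurable_fun => x; apply/cvgrPdist_lt => e e0; near=> y.
apply: (le_lt_trans (shrink_lip _ _)); near: y.
by exists e.
Unshelve. all: by end_near. Qed.

Let unshrink_raw_continuous s : 0 < s < 1 ->
  {for s, continuous (fun s : R => (2 * s - 1) / (1 - `|2 * s - 1|))}.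
Proof.
move=> /andP[s0 s1].
have cl : {for s, continuous (fun s : R => 2 * s - 1)}.
  apply: cvgB; last exact: cvg_cst.
  by apply: cvgM; [exact: cvg_cst|exact: cvg_id].
apply: cvgM; first exact: cl.
apply: cvgV; last by apply: cvgB; [exact: cvg_cst|apply: cvg_norm; exact: cl].
by rewrite subr_eq0 eq_sym lt_eqF// ltr_norml; apply/andP; split; lra.
Qed.

Lemma unshrink_continuous s : 0 < s < 1 -> {for s, continuous unshrink}.
Proof.
move=> s01; have sn : nbhs s (`]0, 1[%classic : set R).
  by apply: open_nbhs_nbhs; split; [exact: interval_open|rewrite /= in_itv].
have E : forall s, 0 < s < 1 -> unshrink s = (2 * s - 1) / (1 - `|2 * s - 1|).
  by move=> t t01; rewrite /unshrink patchE ifT// inE/= in_itv.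
rewrite /prop_for /continuous_at (E s s01).
apply: cvg_trans (unshrink_raw_continuous s01).
apply: near_eq_cvg; apply: filterS sn => t /=; rewrite in_itv/= => t01.
by rewrite E.
Qed.

Lemma measurable_unshrink : measurable_fun setT unshrink.
Proof.
apply/(measurable_restrictT _ _).1 => //.
apply: open_continuous_measurable_fun; first exact: interval_open.
by move=> s; rewrite inE/= in_itv/=; exact: unshrink_raw_continuous.
Qed.

End Shrink.

Section ShrinkedLimit.
Local Open Scope ereal_scope.
Context d (T : measurableType d) {R : realType} (P : probability T R).
Variables (B_ : nat -> T -> R) (B : T -> R).
Variables (nu_ : nat -> probability R R) (nu : probability R R).
Hypotheses (mB_ : forall n, measurable_fun setT (B_ n)) (mB : measurable_fun setT B).
Hypothesis lawB_ : forall n S, measurable S ->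
  P (B_ n @^-1` S) = nu_ n (shrink @^-1` S).

Hypothesis cB : {ae P, forall w, B_ n w @[n --> \oo] --> B w}.
Hypothesis cnu : forall f, lip_test f ->
  \int[nu_ n]_x (f x)%:E @[n --> \oo] --> \int[nu]_x (f x)%:E.

(** The integrals of f (B_ n) have two limits: the integral of f (B) by dominated convergence, and
    that of [f \o shrink] under [nu] by hypothesis. Tests determine the law. *)
Lemma shrink_limit_law S : measurable S -> P (B @^-1` S) = nu (shrink @^-1` S).
Proof.
pose B1 : {mfun T >-> R} := HB.pack B (isMeasurableFun.Build _ _ _ _ _ mB).
pose s1 : {mfun R >-> R} := HB.pack (@shrink R)
  (isMeasurableFun.Build _ _ _ _ _ (@measurable_shrink R)).
move: S; suff : forall S, measurable S -> distribution P B1 S = distribution nu s1 S by [].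
apply: lip_test_unique => f tf.
have mf : measurable_fun setT (fun x => (f x)%:E).
  by apply/measurable_EFinP; exact: measurable_lip_test.
have f0 x : 0 <= (f x)%:E by have [/(_ x)/andP[? _] _] := tf; rewrite lee_fin.
rewrite ge0_integral_distribution// [RHS]ge0_integral_distribution//.
have cl : \int[P]_w (f (B_ n w))%:E @[n --> \oo] --> \int[P]_w (f (B w))%:E.
  have h1 n : measurable_fun setT (fun w => (f (B_ n w))%:E).
    exact: (measurableT_comp mf (mB_ n)).
  have h2 : measurable_fun setT (fun w => (f (B w))%:E).
    exact: (measurableT_comp mf mB).
  have h3 : {ae P, forall w, setT w -> (f (B_ n w))%:E @[n --> \oo] --> (f (B w))%:E}.
    apply: filterS cB => w cw _; apply: cvg_EFin; first exact: nearW.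
    by apply: (cvg_comp _ _ cw); exact: lip_test_continuous.
  have h4 : P.-integrable setT (cst 1).
    exact: (finite_measure_integrable_cst P 1 measurableT).
  have h5 : {ae P, forall w n, setT w -> `|(f (B_ n w))%:E| <= cst 1 w}.
    apply: aeW => w n _; rewrite /= lee_fin.
    by have [/(_ (B_ n w))/andP[? ?] _] := tf; rewrite ger0_norm.
  by have [] := dominated_convergence measurableT h1 h2 h3 h4 h5.
have cr := cnu (lip_test_comp tf (@shrink_lip R)).
have E n : \int[P]_w (f (B_ n w))%:E = \int[nu_ n]_x ((f \o shrink) x)%:E.
  by apply: (ge0_integral_law (mB_ n) (@measurable_shrink R) (lawB_ n) mf).
move: cl; rewrite (_ : (fun n => _) = fun n => \int[nu_ n]_x ((f \o shrink) x)%:E).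
  by move=> cl; exact: cvg_unique cl cr.
exact/funext.
Qed.

Lemma unshrink_limit_law S : measurable S -> P ((unshrink \o B) @^-1` S) = nu S.
Proof.
move=> mS; rewrite comp_preimage shrink_limit_law.
  by congr (nu _); apply/seteqP; split => x /=; rewrite shrinkK.
by rewrite -[X in measurable X]setTI; exact: measurable_unshrink.
Qed.

(* No mass escapes: the limit [B] lies in the open interval almost surely. *)
Lemma unshrink_limit_cvg :
  {ae P, forall w, unshrink (B_ n w) @[n --> \oo] --> unshrink (B w)}.
Proof.
have mI : measurable (`]0%R, 1%R[%classic : set R) by exact: measurable_itv.
have : P (B @^-1` `]0%R, 1%R[%classic) = 1.
  rewrite shrink_limit_law// (_ : _ @^-1` _ = setT) ?probability_setT//.
  by apply/seteqP; split => // x _; rewrite /= in_itv/= shrink_itv.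
have mBI : measurable (B @^-1` `]0%R, 1%R[%classic).
  by rewrite -[X in measurable X]setTI; exact: mB.
move=> P1.
have : {ae P, forall w, (0 < B w < 1)%R}.
  exists (~` (B @^-1` `]0%R, 1%R[%classic)); split; first exact: measurableC.
    by rewrite [LHS]probability_setC// P1 subee.
  by move=> w; apply: contra_not; rewrite /= in_itv.
apply: filterS2 cB => w cw w01.
by apply: (cvg_comp _ _ cw); exact: unshrink_continuous.
Qed.

End ShrinkedLimit.

Section ContinuousMeasurable.
Context {R : realType}.

(** The sigma-algebra of the plane is the product one, so the preimage of an open ray is written as
    a countable union of rational squares. *)
Lemma continuous_measurable_fun2 (c : R * R -> R) :
  continuous c -> measurable_fun setT c.
Proof.
move=> cc; apply: (measurability _ (RGenOInfty.measurableE R)).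
move=> _ [_ [t ->] <-]; rewrite setTI.
pose box (a b r : rat) : set (R * R) :=
  [set p | `|p.1 - ratr a| < ratr r /\ `|p.2 - ratr b| < ratr r].
have mbox a b r : measurable (box a b r).
  rewrite (_ : box a b r = `](ratr a - ratr r), (ratr a + ratr r)[%classic `*`
                           `](ratr b - ratr r), (ratr b + ratr r)[%classic); last first.
    by apply/seteqP; split=> -[x y]; rewrite /box /= !in_itv/= !ltr_distl => -[].
  by apply: measurableX; exact: measurable_itv.
rewrite (_ : _ @^-1` _ = \bigcup_a \bigcup_b \bigcup_r
   [set p | box a b r p /\ forall q, box a b r q -> t < c q]); last first.
  apply/seteqP; split => [p|p [a _] [b _] [r _] [pb /(_ _ pb)]]; last by rewrite /= in_itv/= andbT.
  rewrite /= in_itv/= andbT => tp.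
  have : nbhs p (c @^-1` `]t, +oo[%classic).
    apply: cc; apply: open_nbhs_nbhs; split; first exact: interval_open.
    by rewrite /= in_itv/= tp.
  case=> -[V1 V2] /= [[e1 /= e10 V1e] [e2 /= e20 V2e]] V12.
  have e0 : 0 < Num.min e1 e2 / 2 by rewrite divr_gt0// lt_min e10.
  (* Two points of a square of half-side r differ by less than 2r in each coordinate; hence r below
     half of the smaller radius. *)
  have [r] := rat_in_itvoo e0; rewrite in_itv/= => /andP[r0 re].
  have [a] := @rat_in_itvoo R (p.1 - ratr r) p.1 (ltac:(by rewrite ltrBlDr ltrDl)).
  have [b] := @rat_in_itvoo R (p.2 - ratr r) p.2 (ltac:(by rewrite ltrBlDr ltrDl)).
  rewrite !in_itv/= => /andP[b1 b2] /andP[a1 a2].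
  have pb : box a b r p.
    by split; rewrite ltr_norml; apply/andP; split; lra.
  exists a => //; exists b => //; exists r => //; split=> // q [q1 q2].
  have le1 : Num.min e1 e2 <= e1 by rewrite ge_min lexx.
  have le2 : Num.min e1 e2 <= e2 by rewrite ge_min lexx orbT.
  have := V12 q; rewrite /= in_itv/= andbT; apply; case: pb => p1 p2.
  move: q1 q2 p1 p2; rewrite !ltr_norml.
  move=> /andP[? ?] /andP[? ?] /andP[? ?] /andP[? ?].
  by split; [apply: V1e|apply: V2e]; rewrite /ball_/= ltr_norml; apply/andP; split; lra.
apply: bigcupT_measurable_rat => a; apply: bigcupT_measurable_rat => b.
apply: bigcupT_measurable_rat => r.
have [h|h] := pselect (forall q, box a b r q -> t < c q).
  rewrite (_ : [set p | _] = box a b r)//.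
  by apply/seteqP; split => p; [case|].
by rewrite (_ : [set p | _] = set0)//; apply/seteqP; split => p //= -[].
Qed.

End ContinuousMeasurable.

(** * Martingales and test functions *)

Lemma indic_preimage {R : realType} (S S' : Type) (f : S -> S') (B : set S') w :
  \1_(f @^-1` B) w = \1_B (f w) :> R.
Proof. by rewrite !indicE; congr (_%:R); apply/idP/idP; rewrite !inE. Qed.

Section Orthogonality.
Local Open Scope ereal_scope.
Context d (T : measurableType d) {R : realType} (Q : probability T R).
Implicit Types (D h : T -> R) (A : set T) (G : set (set T)).

Lemma integral_setE A D : \int[Q]_(w in A) (D w)%:E = \int[Q]_w (D w * \1_A w)%:E.
Proof.
rewrite integral_mkcond; apply: eq_integral => w _; rewrite patchE indicE.
by case: (w \in A); rewrite ?mulr1 ?mulr0.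
Qed.

Lemma integrable_mul01 D h : Q.-integrable setT (EFin \o D) ->
  measurable_fun setT h -> (forall w, 0 <= h w <= 1)%R ->
  Q.-integrable setT (fun w => (D w * h w)%:E).
Proof.
move=> iD mh h01; apply: (le_integrable _ _ _ iD) => //.
  apply/measurable_EFinP; apply: measurable_funM => //.
  by apply/measurable_EFinP; exact: measurable_int iD.
move=> w _; have /andP[h0 h1] := h01 w.
by rewrite /= lee_fin normrM (ger0_norm h0) -[leRHS]mulr1 ler_wpM2l.
Qed.

Lemma indic01 A w : (0 <= (\1_A w : R) <= 1)%R.
Proof. by rewrite indicE; case: (_ \in _); rewrite ?lexx ler01. Qed.

(** By [bit_doubling], h is the mean of its first digit and of [doubling] of h; the digit is the
    indicator of h >= 1/2 and contributes the integral assumed to vanish. *)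
Lemma integral_mul_doubling D h A : Q.-integrable setT (EFin \o D) ->
  measurable_fun setT h -> (forall w, 0 <= h w <= 1)%R -> measurable A ->
  \int[Q]_(w in A `&` h @^-1` `[2^-1%R, +oo[) (D w)%:E = 0 ->
  \int[Q]_(w in A) (D w * h w)%:E =
  2^-1%:E * \int[Q]_(w in A) (D w * doubling (h w))%:E.
Proof.
move=> iD mh h01 mA; rewrite integral_setE => z.
have mdh : measurable_fun setT (doubling \o h).
  exact: (measurableT_comp measurable_doubling mh).
have dh01 w : (0 <= doubling (h w) <= 1)%R by exact: doubling01.
rewrite 2!(integral_setE A) -integralZl//; last first.
  apply: (integrable_mul01 (D := fun w => (D w * doubling (h w))%R)).
  - exact: (integrable_mul01 iD mdh).
  - exact: measurable_indic.
  - exact: indic01.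
have -> : \int[Q]_w (D w * h w * \1_A w)%:E =
   \int[Q]_w ((2^-1 * (D w * \1_(A `&` h @^-1` `[2^-1%R, +oo[) w))%:E +
              2^-1%:E * (D w * doubling (h w) * \1_A w)%:E).
  apply: eq_integral => w _; rewrite -EFinM -EFinD; congr EFin.
  have -> : (\1_(A `&` h @^-1` `[2^-1%R, +oo[) w = \1_A w * bit (h w))%R.
    rewrite indicI; congr (_ * _)%R; rewrite indicE /bit; congr (_%:R)%R.
    by congr nat_of_bool; apply/idP/idP; rewrite inE/= in_itv/= andbT.
  by rewrite {1}(bit_doubling (h w)); ring.
have mAh : measurable (A `&` h @^-1` `[2^-1%R, +oo[).
  by apply: measurableI => //; rewrite -[X in measurable X]setTI; apply: mh => //; exact: measurable_itv.
have i1 : Q.-integrable setT (fun w => (D w * \1_(A `&` h @^-1` `[2^-1%R, +oo[) w)%:E).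
  by apply: integrable_mul01 => //; exact: indic01.
have i2 : Q.-integrable setT (fun w => (D w * doubling (h w) * \1_A w)%:E).
  apply: (integrable_mul01 (D := fun w => (D w * doubling (h w))%R)).
  - exact: (integrable_mul01 iD mdh).
  - exact: measurable_indic.
  - exact: indic01.
transitivity (\int[Q]_w (2^-1%:E * (D w * \1_(A `&` h @^-1` `[2^-1%R, +oo[) w)%:E +
    2^-1%:E * (D w * doubling (h w) * \1_A w)%:E)); first by [].
rewrite integralD//; [|exact: integrableZl..].
by rewrite (integralZl _ i1)// z mule0 add0e.
Qed.

(* Peeling off the binary digits of [h] one at a time: each digit is the
   indicator of a set of [G], and the remainder halves at every step. *)
Lemma orthogonal_mul01 D h G : Q.-integrable setT (EFin \o D) ->
  G `<=` measurable -> setI_closed G ->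
  (forall A, G A -> \int[Q]_(w in A) (D w)%:E = 0) ->
  (forall B, measurable B -> G (h @^-1` B)) -> (forall w, 0 <= h w <= 1)%R ->
  forall A, G A -> \int[Q]_(w in A) (D w * h w)%:E = 0.
Proof.
move=> iD Gm GI DG hG h01 A GA.
have mA : measurable A by exact: Gm.
(* The induction runs over all g, since each step replaces g by [doubling \o g], whose preimages are
   still in G. *)
have key n (g : T -> R) : (forall B, measurable B -> G (g @^-1` B)) ->
    (forall w, 0 <= g w <= 1)%R ->
    `|\int[Q]_(w in A) (D w * g w)%:E| <= (2^-1 ^+ n)%:E * \int[Q]_w `|(D w)%:E|.
  elim: n g => [|n ih] g gG g01.
    have mg : measurable_fun setT g by move=> _ B mB; rewrite setTI; exact/Gm/gG.
    have ig := integrable_mul01 iD mg g01.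
    rewrite expr0 mul1e (integral_setE A).
    have iAg : Q.-integrable setT (fun w => (D w * g w * \1_A w)%:E).
      by apply: (integrable_mul01 (D := fun w => (D w * g w)%R)) => //; exact: indic01.
    apply: (le_trans (le_abse_integral _ _ _)) => //; first exact: measurable_int iAg.
    apply: ge0_le_integral => //.
    - by apply: measurableT_comp => //; exact: measurable_int iAg.
    - by apply: measurableT_comp => //; exact: measurable_int iD.
    - move=> w _; rewrite lee_fin !normrM -[leRHS]mulr1 -mulrA ler_wpM2l//.
      have /andP[? ?] := g01 w; have /andP[? ?] := indic01 A w.
      by rewrite !ger0_norm// mulr_ile1.
  have mg : measurable_fun setT g by move=> _ B mB; rewrite setTI; exact/Gm/gG.
  rewrite integral_mul_doubling//; last first.
    by apply: DG; apply: GI => //; apply: gG; exact: measurable_itv.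
  rewrite abseM gee0_abs ?lee_fin ?invr_ge0// exprS EFinM -muleA.
  rewrite lee_wpmul2l ?lee_fin ?invr_ge0//; apply: ih => [B mB|w]; last exact: doubling01.
  rewrite (_ : _ @^-1` B = g @^-1` (doubling @^-1` B))//; apply: gG.
  by rewrite -[X in measurable X]setTI; exact: measurable_doubling.
have fI : \int[Q]_w `|(D w)%:E| \is a fin_num.
  by apply: integrable_fin_num => //; exact: integrable_abse.
apply/eqP; rewrite -abse_eq0 eq_le abse_ge0 andbT.
have : (2^-1 ^+ n)%:E * \int[Q]_w `|(D w)%:E| @[n --> \oo] --> 0.
  rewrite -(fineK fI) -[X in _ --> X](mul0e (fine (\int[Q]_w `|(D w)%:E|))%:E).
  apply: cvgeZr => //; apply: cvg_EFin; first exact: nearW.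
  have := @cvg_geometric R 1 2^-1 _; rewrite /geometric/=.
  by under eq_fun do rewrite mul1r; apply; rewrite ger0_norm//; lra.
by move=> cv0; apply: (cvge_ge _ cv0); apply: nearW => n; exact: key.
Qed.

End Orthogonality.

Section TestsToSigmaAlgebra.
Local Open Scope ereal_scope.
Context d (T : measurableType d) {R : realType} (Q : probability T R).
Variables (D U V : T -> R).
Hypotheses (iD : Q.-integrable setT (EFin \o D)).
Hypotheses (mU : measurable_fun setT U) (mV : measurable_fun setT V).
Hypothesis DUV : forall f g, lip_test f -> lip_test g ->
  \int[Q]_w (D w * (f (U w) * g (V w)))%:E = 0.

Let Pi : set (set T) := [set U @^-1` B `&` V @^-1` C | B in
  [set B | measurable B /\ approximable B] & C in
  [set C | measurable C /\ approximable C]].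

Let PiI : setI_closed Pi.
Proof.
move=> _ _ [B [mB aB] [C [mC aC] <-]] [B' [mB' aB'] [C' [mC' aC'] <-]].
exists (B `&` B'); first by split; [exact: measurableI|exact: approximableI].
exists (C `&` C'); first by split; [exact: measurableI|exact: approximableI].
by rewrite !preimage_setI setIACA.
Qed.

Let Pim : Pi `<=` measurable.
Proof.
move=> _ [B [mB _] [C [mC _] <-]]; apply: measurableI.
  by rewrite -[X in measurable X]setTI; exact: mU.
by rewrite -[X in measurable X]setTI; exact: mV.
Qed.

Let Pi0 A : Pi A -> \int[Q]_(w in A) (D w)%:E = 0.
Proof.
move=> PA; have mA := Pim PA; rewrite (integral_setE Q A).
case: PA => B [mB [f [tf cf]]] [C [mC [g [tg cg]]] E].
have t01 n w : (0 <= f n (U w) * g n (V w) <= 1)%R.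
  have [/(_ (U w))/andP[? ?] _] := tf n; have [/(_ (V w))/andP[? ?] _] := tg n.
  by rewrite mulr_ge0//= mulr_ile1.
have mfg n : measurable_fun setT (fun w => f n (U w) * g n (V w))%R.
  apply: measurable_funM.
    exact: (measurableT_comp (measurable_lip_test (tf n)) mU).
  exact: (measurableT_comp (measurable_lip_test (tg n)) mV).
have h1 n : measurable_fun setT (fun w => (D w * (f n (U w) * g n (V w)))%:E).
  exact: measurable_int (integrable_mul01 iD (mfg n) (t01 n)).
have h2 : measurable_fun setT (fun w => (D w * \1_A w)%:E).
  apply: measurable_int (integrable_mul01 iD _ (indic01 A)).
  exact: measurable_indic.
have h3 : {ae Q, forall w, setT w ->
    (D w * (f n (U w) * g n (V w)))%:E @[n --> \oo] --> (D w * \1_A w)%:E}.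
  apply: aeW => w _; apply: cvg_EFin; first exact: nearW.
  apply: cvgM; first exact: cvg_cst.
  have -> : \1_A w = (\1_B (U w) * \1_C (V w) : R)%R by rewrite -E indicI /= !indic_preimage.
  by apply: cvgM; [exact: cf|exact: cg].
have h4 := integrable_abse iD.
have h5 : {ae Q, forall w n, setT w ->
    `|(D w * (f n (U w) * g n (V w)))%:E| <= (abse \o (EFin \o D)) w}.
  apply: aeW => w n _; have /andP[? ?] := t01 n w.
  by rewrite /= lee_fin normrM (ger0_norm (x := _ * _)%R)// -[leRHS]mulr1 ler_wpM2l.
have [_ _] := dominated_convergence measurableT h1 h2 h3 h4 h5.
under eq_fun do rewrite DUV//.
by move=> H; exact: (cvg_unique _ H (cvg_cst _)).
Qed.

Let PiT : Pi setT.
Proof.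
exists setT; first by split; [exact: measurableT|exact: approximableT].
exists setT; first by split; [exact: measurableT|exact: approximableT].
by rewrite !preimage_setT setIT.
Qed.

Let sigmaPi0 A : <<s Pi >> A -> \int[Q]_(w in A) (D w)%:E = 0.
Proof.
move=> sA; suff : <<s Pi >> `<=` [set A | measurable A /\
    \int[Q]_(w in A) (D w)%:E = 0] by move=> /(_ _ sA)[].
apply: (lambda_system_subset PiI) => //; last first.
  by move=> B PB; split; [exact: Pim|exact: Pi0].
apply/dynkin_lambda_system; split.
- by split; [exact: measurableT|exact: (Pi0 PiT)].
- move=> B [mB B0]; split; first exact: measurableC.
  have mD : measurable_fun setT (EFin \o D) by exact: measurable_int iD.
  have := @integral_setU _ _ _ Q B (~` B) (EFin \o D) mB (measurableC mB).
  rewrite setUv => /(_ mD); rewrite B0 add0e => <-; first exact: (Pi0 PiT).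
  by apply/disj_setPS => w [].
- move=> F tF HF; have mF k : measurable (F k) by case: (HF k).
  have mUF : measurable (\bigcup_k F k) by exact: bigcupT_measurable.
  split => //; rewrite integral_bigcup//; last exact: integrableS iD.
  by apply: eseries0 => k _ _; case: (HF k).
Qed.

Let sigma_preimage (W : T -> R) :
  (forall B, measurable B -> approximable B -> Pi (W @^-1` B)) ->
  forall B, measurable B -> <<s Pi >> (W @^-1` B).
Proof.
move=> PW B mB.
suff : (@measurable _ R) `<=` image_set_system setT W <<s Pi >>.
  by move=> /(_ _ mB); rewrite /image_set_system/= setTI.
rewrite [X in X `<=` _](RGenOInfty.measurableE R); apply: smallest_sub.
  exact/sigma_algebra_image/smallest_sigma_algebra.
move=> _ [t ->]; rewrite /image_set_system/= setTI; apply: sub_sigma_algebra.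
by apply: PW; [exact: measurable_itv|exact: approximable_ray].
Qed.

(** Dominated convergence, with bound |D|, carries the hypothesis from tests to the rectangles of
    [Pi]. The sets over which D integrates to 0 form a lambda-system, so they include the generated
    sigma-algebra. *)
Lemma lip_test_sigma_algebra A :
  <<s preimage_set_system setT U measurable `|`
      preimage_set_system setT V measurable >> A ->
  \int[Q]_(w in A) (D w)%:E = 0.
Proof.
move=> sA; apply: sigmaPi0; move: A sA.
apply: smallest_sub; first exact: smallest_sigma_algebra.
move=> _ [] [B mB <-]; rewrite setTI; apply: sigma_preimage mB => C mC aC.
- exists C => //; exists setT; last by rewrite preimage_setT setIT.
  by split; [exact: measurableT|exact: approximableT].
- exists setT; first by split; [exact: measurableT|exact: approximableT].
  by exists C => //; rewrite preimage_setT setTI.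
Qed.

End TestsToSigmaAlgebra.

Section Martingales.
Local Open Scope ereal_scope.
Context d (T : measurableType d) {R : realType} (Q : probability T R).
Context n (X : 'I_n -> T -> R).

Lemma natural_filtration_preimage (i j : 'I_n) B : (j <= i)%N ->
  measurable B -> natural_filtration X i (X j @^-1` B).
Proof.
move=> ji mB; apply: sub_sigma_algebra; exists j => //.
by exists B => //; rewrite setTI.
Qed.

Lemma natural_filtration_measurable (i : 'I_n) :
  (forall j, measurable_fun setT (X j)) -> natural_filtration X i `<=` measurable.
Proof.
move=> mX; apply: smallest_sub; first exact: sigma_algebra_measurable.
by move=> _ [j _ [B mB <-]]; exact: mX.
Qed.

Lemma natural_filtrationI (i : 'I_n) : setI_closed (natural_filtration X i).
Proof.
have [] := smallest_sigma_algebra setT (\bigcup_(j in [set j : 'I_n | (j <= i)%N])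
  preimage_set_system setT (X j) measurable).
rewrite -/(natural_filtration X i) => G0 GC GU A B GA GB.
rewrite -[A `&` B]setCK setCI -bigcup2E -setTD; apply: (GC); apply: GU => -[|[|k]] //=.
  by rewrite -setTD; exact: GC.
by rewrite -setTD; exact: GC.
Qed.

Lemma martingale_intro : (forall i, Q.-integrable setT (EFin \o X i)) ->
  (forall i j : 'I_n, (i <= j)%N -> forall A, natural_filtration X i A ->
    \int[Q]_(w in A) (X i w)%:E = \int[Q]_(w in A) (X j w)%:E) ->
  martingale Q X.
Proof.
move=> iX XA; split=> // i j ij; split => //; last exact: XA.
by move=> B; exact: natural_filtration_preimage.
Qed.

Lemma integral_set_diff0 (Y Z : T -> R) A : measurable A ->
  Q.-integrable setT (EFin \o Y) -> Q.-integrable setT (EFin \o Z) ->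
  \int[Q]_(w in A) (Y w)%:E = \int[Q]_(w in A) (Z w)%:E <->
  \int[Q]_(w in A) ((Z w - Y w)%R)%:E = 0.
Proof.
move=> mA iY iZ.
have iYA : Q.-integrable A (EFin \o Y) by exact: integrableS iY.
have iZA : Q.-integrable A (EFin \o Z) by exact: integrableS iZ.
have fY : \int[Q]_(w in A) (Y w)%:E \is a fin_num by exact: integrable_fin_num iYA.
have fZ : \int[Q]_(w in A) (Z w)%:E \is a fin_num by exact: integrable_fin_num iZA.
have -> : \int[Q]_(w in A) ((Z w - Y w)%R)%:E =
    \int[Q]_(w in A) (Z w)%:E - \int[Q]_(w in A) (Y w)%:E.
  exact: (integralB mA iZA iYA).
split=> [->|/eqP]; first by rewrite subee.
by rewrite sube_eq ?add0e// ?fin_num_adde_defl// => /eqP.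
Qed.

(** Two applications of [orthogonal_mul01]: first to the increment with factor f, then to the
    increment times f with factor g. *)
Lemma martingale_lip_test (i j a b : 'I_n) f g : martingale Q X ->
  (i <= j)%N -> (a <= i)%N -> (b <= i)%N -> lip_test f -> lip_test g ->
  \int[Q]_w ((X j w - X i w) * (f (X a w) * g (X b w)))%:E = 0.
Proof.
move=> [iX mart] ij ai bi tf tg.
have mX k : measurable_fun setT (X k).
  by apply/measurable_EFinP; exact: measurable_int (iX k).
have Gm := @natural_filtration_measurable i mX.
have GI := @natural_filtrationI i.
have [_ _ XA] := mart i j ij.
have iD : Q.-integrable setT (EFin \o (fun w => X j w - X i w)%R).
  exact: (integrableB measurableT (iX j) (iX i)).
have DG A : natural_filtration X i A -> \int[Q]_(w in A) ((X j w - X i w)%R)%:E = 0.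
  by move=> GA; apply/integral_set_diff0 => //; [exact: Gm|exact: XA].
have hG (k : 'I_n) (h : R -> R) (B : set R) : (k <= i)%N -> lip_test h -> measurable B ->
    natural_filtration X i ((h \o X k) @^-1` B).
  move=> ki th mB; rewrite comp_preimage; apply: natural_filtration_preimage => //.
  by rewrite -[X in measurable X]setTI; exact: measurable_lip_test.
have DG1 := orthogonal_mul01 iD Gm GI DG (fun B => hG a f B ai tf) (fun w => tf.1 _).
have iD1 : Q.-integrable setT (EFin \o (fun w => (X j w - X i w) * f (X a w))%R).
  apply: (integrable_mul01 iD) => [|w]; last exact: tf.1.
  exact: (measurableT_comp (measurable_lip_test tf) (mX a)).
have DG2 := orthogonal_mul01 iD1 Gm GI DG1 (fun B => hG b g B bi tg) (fun w => tg.1 _).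
under eq_integral do rewrite mulrA.
by apply: DG2; rewrite -(preimage_setT (X i)); exact: natural_filtration_preimage.
Qed.

End Martingales.

Section MartingalePushforward.
Local Open Scope ereal_scope.
Context d d' (T : measurableType d) (T' : measurableType d') {R : realType}.
Variables (Q : probability T R) (Q' : probability T' R) (phi : T -> T').
Hypothesis mphi : measurable_fun setT phi.
Hypothesis lawphi : forall B, measurable B -> Q' B = Q (phi @^-1` B).

(** The map s selects times of [X]. As it is monotone, an event of the past of [X'] at i pulls back
    into the past of [X] at s i, where the martingale identity is available. *)
Lemma martingale_pushforward n m (s : 'I_m -> 'I_n)
    (X : 'I_n -> T -> R) (X' : 'I_m -> T' -> R) :
  (forall i j : 'I_m, (i <= j)%N -> (s i <= s j)%N) ->
  (forall i, measurable_fun setT (X' i)) ->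
  (forall i w, X' i (phi w) = X (s i) w) ->
  martingale Q X -> martingale Q' X'.
Proof.
move=> sle mX' X'E [iX mart].
have mX k : measurable_fun setT (X' k) by [].
have law' B : measurable B -> Q (phi @^-1` B) = Q' (idfun @^-1` B).
  by move=> mB; rewrite lawphi// preimage_id.
have XE i : X' i \o phi = X (s i) by apply/funext => w; exact: X'E.
have iX' i : Q'.-integrable setT (EFin \o X' i).
  have mEX : measurable_fun setT (EFin \o X' i) by exact/measurable_EFinP.
  apply: (integrable_law mphi (@measurable_id _ _ setT) law' mEX).
  by have := iX (s i); rewrite -XE.
apply: martingale_intro => // i j ij A GA.
have mA : measurable A by apply: natural_filtration_measurable GA.
have GpA : natural_filtration X (s i) (phi @^-1` A).
  have : image_set_system setT phi (natural_filtration X (s i)) A.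
    move: A GA {mA}; apply: smallest_sub.
      exact/sigma_algebra_image/smallest_sigma_algebra.
    move=> _ [k /= ki [B mB <-]]; rewrite /image_set_system/= !setTI.
    rewrite -comp_preimage XE; apply: natural_filtration_preimage => //.
    exact: sle.
  by rewrite /image_set_system/= setTI.
have E k : \int[Q']_(w in A) (X' k w)%:E = \int[Q]_(w in phi @^-1` A) (X (s k) w)%:E.
  rewrite (integral_setE Q' A) (integral_setE Q (phi @^-1` A)).
  have mf : measurable_fun setT (fun w => (X' k w * \1_A w)%:E).
    by apply/measurable_EFinP; apply: measurable_funM => //; exact: measurable_indic.
  have := integral_law mphi (@measurable_id _ _ setT) law' mf => /= <-.
  by apply: eq_integral => w _; rewrite X'E indic_preimage.
have [_ _ XA] := mart _ _ (sle _ _ ij).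
by rewrite !E XA.
Qed.

End MartingalePushforward.

(** * Mixtures *)

Section MixtureOnT.
Context d (T : measurableType d) {R : realType} (t : {i01 R}).
Variables P1 P2 : probability T R.

(** The construction of [mixture] on an arbitrary space, for laws of triples. *)
Definition mixture_law : set T -> \bar R :=
  measure_add (mscale (t%:num)%:nng P1) (mscale (1 - t%:num)%:nng P2).

HB.instance Definition _ := Measure.on mixture_law.

Lemma mixture_lawE A :
  mixture_law A = ((t%:num)%:E * P1 A + (1 - t%:num)%:E * P2 A)%E.
Proof. by rewrite /mixture_law measure_addE. Qed.

Let mixture_law_setT : mixture_law setT = 1%E.
Proof. by rewrite mixture_lawE !probability_setT !mule1 -EFinD addrC subrK. Qed.

HB.instance Definition _ :=
  Measure_isProbability.Build _ _ _ mixture_law mixture_law_setT.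

End MixtureOnT.

Section IntegralMixture.
Local Open Scope ereal_scope.
Context d (T : measurableType d) {R : realType}.
Variables (P P1 P2 : probability T R) (t s : R).
Hypotheses (t0 : (0 <= t)%R) (s0 : (0 <= s)%R) (ts : (t + s = 1)%R).
Hypothesis PE : forall A, measurable A -> P A = t%:E * P1 A + s%:E * P2 A.

Lemma ge0_integral_mix D (f : T -> \bar R) : measurable D -> measurable_fun D f ->
  (forall x, D x -> 0 <= f x) ->
  \int[P]_(x in D) f x = t%:E * \int[P1]_(x in D) f x + s%:E * \int[P2]_(x in D) f x.
Proof.
move=> mD mf f0; pose a := NngNum t0; pose b := NngNum s0.
rewrite (eq_measure_integral (measure_add (mscale a P1) (mscale b P2))); last first.
  by move=> A mA _; rewrite [RHS]measure_addE; exact: PE.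
by rewrite ge0_integral_measure_add// !ge0_integral_mscale.
Qed.

Lemma integrable_mix (f : T -> \bar R) :
  P1.-integrable setT f -> P2.-integrable setT f -> P.-integrable setT f.
Proof.
move=> /integrableP[mf f1] /integrableP[_ f2]; apply/integrableP; split=> //.
rewrite ge0_integral_mix//; last exact: measurableT_comp.
by apply: lte_add_pinfty; apply: lte_mul_pinfty.
Qed.

Lemma integrable_mixl (f : T -> \bar R) : (0 < t)%R ->
  P.-integrable setT f -> P1.-integrable setT f.
Proof.
move=> tgt0 /integrableP[mf]; rewrite ge0_integral_mix//; last exact: measurableT_comp.
move=> h; apply/integrableP; split=> //; rewrite ltey; apply: contraTN h => /eqP ->.
rewrite gt0_muley ?lte_fin// addye ?ltxx//.
have : 0 <= s%:E * \int[P2]_x `|f x| by rewrite mule_ge0 ?lee_fin//; exact: integral_ge0.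
by case: (s%:E * _).
Qed.

Lemma integral_mix D (f : T -> \bar R) : measurable D ->
  P1.-integrable D f -> P2.-integrable D f ->
  \int[P]_(x in D) f x = t%:E * \int[P1]_(x in D) f x + s%:E * \int[P2]_(x in D) f x.
Proof.
move=> mD i1 i2; have mf := measurable_int _ i1.
rewrite integralE (integralE P1) (integralE P2) !ge0_integral_mix//;
  [|exact: measurable_funeneg|exact: measurable_funepos].
have := integrable_pos_fin_num mD i1; have := integrable_neg_fin_num mD i1.
have := integrable_pos_fin_num mD i2; have := integrable_neg_fin_num mD i2.
move: (\int[P1]_(x in D) f^\+ x) (\int[P1]_(x in D) f^\- x)
  (\int[P2]_(x in D) f^\+ x) (\int[P2]_(x in D) f^\- x).
move=> [a| |] [b| |] [c| |] [e| |]// _ _ _ _.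
change ((t * a + s * c - (t * b + s * e))%:E = (t * (a - b) + s * (c - e))%:E).
by congr EFin; ring.
Qed.

End IntegralMixture.

Section ConvexOrderMixture.
Local Open Scope ereal_scope.
Context {R : realType} (t : {i01 R}) (mu nu : probability R R).

Let t0 : (0 <= t%:num)%R. Proof. by []. Qed.
Let s0 : (0 <= 1 - t%:num)%R. Proof. by rewrite subr_ge0. Qed.
Let ts : (t%:num + (1 - t%:num) = 1 :> R)%R. Proof. by rewrite addrC subrK. Qed.
Let mixE A : measurable A ->
  mixture t mu nu A = (t%:num)%:E * mu A + (1 - t%:num)%:E * nu A.
Proof. by move=> _; exact: mixtureE. Qed.
Let mixE' A : measurable A ->
  mixture t mu nu A = (1 - t%:num)%:E * nu A + (t%:num)%:E * mu A.
Proof. by move=> mA; rewrite mixE// addeC. Qed.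

(** Integrability under the mixture reaches a component only if its weight is positive, hence the
    alternatives; a component of weight zero drops out of every integral. *)
Let integrable_parts (f : R -> \bar R) : (mixture t mu nu).-integrable setT f ->
  (t%:num = 0 :> R \/ mu.-integrable setT f)%R /\
  (1 - t%:num = 0 :> R \/ nu.-integrable setT f)%R.
Proof.
move=> fi; split.
  have [->|tn0] := eqVneq (t%:num : R) 0%R; [by left|right].
  by apply: (@integrable_mixl _ _ _ (mixture t mu nu) mu nu _ _ t0 s0 mixE) fi; rewrite lt_neqAle eq_sym tn0.
have [->|sn0] := eqVneq (1 - t%:num : R)%R 0%R; [by left|right].
by apply: (@integrable_mixl _ _ _ (mixture t mu nu) nu mu _ _ s0 t0 mixE') fi; rewrite lt_neqAle eq_sym sn0.
Qed.

Let integral_parts (f : R -> \bar R) : (mixture t mu nu).-integrable setT f ->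
  \int[mixture t mu nu]_x f x =
  (t%:num)%:E * \int[mu]_x f x + (1 - t%:num)%:E * \int[nu]_x f x.
Proof.
move=> fi; have [[tz|imu] [sz|inu]] := integrable_parts fi.
- by have := ts; rewrite tz subr0 add0r in sz *; move: sz => /eqP; rewrite oner_eq0.
- rewrite tz mul0e add0e subr0 mul1e; apply: eq_measure_integral => A mA _.
  by rewrite [LHS]mixE// tz mul0e add0e subr0 mul1e.
- have t1 : t%:num = 1%R :> R by apply/esym/eqP; rewrite -subr_eq0 sz.
  rewrite sz mul0e adde0 t1 mul1e; apply: eq_measure_integral => A mA _.
  by rewrite [LHS]mixE// sz mul0e adde0 t1 mul1e.
- exact: (@integral_mix _ _ _ (mixture t mu nu) mu nu _ _ t0 s0 mixE).
Qed.

Let splitE (x : \bar R) : x \is a fin_num ->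
  x = (t%:num)%:E * x + (1 - t%:num)%:E * x.
Proof. by move=> xf; rewrite -muleDl// -EFinD ts mul1e. Qed.

Lemma convex_order_mixr a : convex_order a mu -> convex_order a nu ->
  convex_order a (mixture t mu nu).
Proof.
move=> amu anu f cf fa fm; have [imu inu] := integrable_parts fm.
rewrite (integral_parts fm).
have fia : \int[a]_x (f x)%:E \is a fin_num by exact: integrable_fin_num fa.
rewrite (splitE fia).
apply: leeD.
  case: imu => [->|imu]; first by rewrite !mul0e.
  by rewrite lee_wpmul2l ?lee_fin//; exact: amu.
case: inu => [->|inu]; first by rewrite !mul0e.
by rewrite lee_wpmul2l ?lee_fin//; exact: anu.
Qed.

Lemma convex_order_mixl a : convex_order mu a -> convex_order nu a ->
  convex_order (mixture t mu nu) a.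
Proof.
move=> mua nua f cf fm fa; have [imu inu] := integrable_parts fm.
rewrite (integral_parts fm).
have fia : \int[a]_x (f x)%:E \is a fin_num by exact: integrable_fin_num fa.
rewrite (splitE fia).
apply: leeD.
  case: imu => [->|imu]; first by rewrite !mul0e.
  by rewrite lee_wpmul2l ?lee_fin//; exact: mua.
case: inu => [->|inu]; first by rewrite !mul0e.
by rewrite lee_wpmul2l ?lee_fin//; exact: nua.
Qed.

End ConvexOrderMixture.

Section MartingaleMixture.
Local Open Scope ereal_scope.
Context d (T : measurableType d) {R : realType} (t : {i01 R}).
Variables P1 P2 : probability T R.

Let t0 : (0 <= t%:num)%R. Proof. by []. Qed.
Let s0 : (0 <= 1 - t%:num)%R. Proof. by rewrite subr_ge0. Qed.
Let mixE A : measurable A ->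
  mixture_law t P1 P2 A = (t%:num)%:E * P1 A + (1 - t%:num)%:E * P2 A.
Proof. by move=> _; exact: mixture_lawE. Qed.

Lemma integral_mixture_law D (f : T -> \bar R) : measurable D ->
  P1.-integrable D f -> P2.-integrable D f ->
  \int[mixture_law t P1 P2]_(x in D) f x =
  (t%:num)%:E * \int[P1]_(x in D) f x + (1 - t%:num)%:E * \int[P2]_(x in D) f x.
Proof. exact: (@integral_mix _ _ _ (mixture_law t P1 P2) P1 P2 _ _ t0 s0 mixE). Qed.

Lemma martingale_mixture n (X : 'I_n -> T -> R) :
  martingale P1 X -> martingale P2 X -> martingale (mixture_law t P1 P2) X.
Proof.
move=> [i1 m1] [i2 m2].
have mX k : measurable_fun setT (X k).
  by apply/measurable_EFinP; exact: measurable_int (i1 k).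
apply: martingale_intro => [i|i j ij A GA]; first exact: (@integrable_mix _ _ _ (mixture_law t P1 P2) P1 P2 _ _ t0 s0 mixE).
have mA : measurable A by apply: natural_filtration_measurable GA.
have iA k : P1.-integrable A (EFin \o X k) /\ P2.-integrable A (EFin \o X k).
  by split; [exact: integrableS (i1 k)|exact: integrableS (i2 k)].
rewrite (integral_mixture_law mA (iA i).1 (iA i).2).
rewrite (integral_mixture_law mA (iA j).1 (iA j).2).
have [_ _ e1] := m1 i j ij; have [_ _ e2] := m2 i j ij.
by rewrite e1// e2.
Qed.

End MartingaleMixture.

(** * Prices and couplings *)

Section CanonicalProcess.
Local Open Scope ereal_scope.
Context {R : realType}.
Local Notation T3 := (R * R * R)%type.

Definition o0 : 'I_3 := @Ordinal 3 0 isT.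
Definition o1 : 'I_3 := @Ordinal 3 1 isT.
Definition o2 : 'I_3 := @Ordinal 3 2 isT.

Lemma I3_ind (P : 'I_3 -> Prop) : P o0 -> P o1 -> P o2 -> forall i, P i.
Proof.
by move=> p0 p1 p2 [[|[|[|//]]] lt]; [move: p0|move: p1|move: p2];
  congr P; apply/val_inj.
Qed.

Lemma I2_ind (P : 'I_2 -> Prop) : P (@Ordinal 2 0 isT) -> P (@Ordinal 2 1 isT) ->
  forall i, P i.
Proof.
by move=> p0 p1 [[|[|//]] lt]; [move: p0|move: p1]; congr P; apply/val_inj.
Qed.

Lemma measurable_canonical3 i : measurable_fun setT (@canonical3 R i).
Proof.
elim/I3_ind: i.
- exact: (@measurable_coord3 R 0).
- exact: (@measurable_coord3 R 1).
- exact: (@measurable_coord3 R 2).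
Qed.

Lemma measurable_canonical2 i : measurable_fun setT (@canonical2 R i).
Proof. by elim/I2_ind: i; [exact: measurable_fst|exact: measurable_snd]. Qed.

(** Only consecutive increments are tested; the step from time 0 to time 2 follows by the inclusion
    of the filtrations. The first family has two factors of the same coordinate so that one
    two-variable lemma serves both steps. *)
Lemma martingale_canonical3 (Q : probability T3 R) :
  (forall i, Q.-integrable setT (EFin \o canonical3 i)) ->
  (forall f g, lip_test f -> lip_test g ->
    \int[Q]_w ((w.1.2 - w.1.1) * (f w.1.1 * g w.1.1))%:E = 0) ->
  (forall f g, lip_test f -> lip_test g ->
    \int[Q]_w ((w.2 - w.1.2) * (f w.1.1 * g w.1.2))%:E = 0) ->
  martingale Q canonical3.
Proof.
move=> iX H01 H12.
have mX i := measurable_canonical3 i.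
have iD i j : Q.-integrable setT (EFin \o (fun w => canonical3 j w - canonical3 i w)%R).
  exact: (integrableB measurableT (iX j) (iX i)).
have step01 A : natural_filtration canonical3 o0 A ->
    \int[Q]_(w in A) (canonical3 o0 w)%:E = \int[Q]_(w in A) (canonical3 o1 w)%:E.
  move=> GA; have mA := natural_filtration_measurable mX GA.
  apply/(integral_set_diff0 mA) => //.
  apply: (lip_test_sigma_algebra (iD o0 o1) (mX o0) (mX o0) H01).
  move: A GA {mA}; apply: smallest_sub; first exact: smallest_sigma_algebra.
  move=> A [j + HB]; elim/I3_ind: j HB => // HB _.
  by apply: sub_sigma_algebra; left.
have step12 A : natural_filtration canonical3 o1 A ->
    \int[Q]_(w in A) (canonical3 o1 w)%:E = \int[Q]_(w in A) (canonical3 o2 w)%:E.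
  move=> GA; have mA := natural_filtration_measurable mX GA.
  apply/(integral_set_diff0 mA) => //.
  apply: (lip_test_sigma_algebra (iD o1 o2) (mX o0) (mX o1) H12).
  move: A GA {mA}; apply: smallest_sub; first exact: smallest_sigma_algebra.
  move=> A [j + HB]; elim/I3_ind: j HB => // HB _; apply: sub_sigma_algebra.
  - by left.
  - by right.
have G01 : @natural_filtration _ T3 R _ canonical3 o0 `<=` natural_filtration canonical3 o1.
  apply: smallest_sub; first exact: smallest_sigma_algebra.
  move=> A [j /= j0 HB]; apply: sub_sigma_algebra; exists j => //=.
  exact: leq_trans j0 _.
apply: martingale_intro => // i j.
elim/I3_ind: i; elim/I3_ind: j => // _ A GA;
  first [by []|exact: step01|exact: step12|by rewrite step01// step12//; exact: G01].
Qed.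

Lemma M3_martingale_tests mu1 mu2 mu3 (Q : probability T3 R) f g :
  M3 mu1 mu2 mu3 Q -> lip_test f -> lip_test g ->
  \int[Q]_w ((w.1.2 - w.1.1) * (f w.1.1 * g w.1.1))%:E = 0 /\
  \int[Q]_w ((w.2 - w.1.2) * (f w.1.1 * g w.1.2))%:E = 0.
Proof.
move=> [_ mart] tf tg; split.
  exact: (@martingale_lip_test _ _ _ _ _ canonical3 o0 o1 o0 o0 _ _ mart).
exact: (@martingale_lip_test _ _ _ _ _ canonical3 o1 o2 o0 o1 _ _ mart).
Qed.

Lemma M3_law mu1 mu2 mu3 (Q : probability T3 R) : M3 mu1 mu2 mu3 Q ->
  [/\ forall A, measurable A -> Q ((fun w => w.1.1) @^-1` A) = mu1 A,
      forall A, measurable A -> Q ((fun w => w.1.2) @^-1` A) = mu2 A &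
      forall A, measurable A -> Q ((fun w => w.2) @^-1` A) = mu3 A].
Proof.
move=> [laws _]; split=> A mA.
- exact: (laws o0 A mA).
- exact: (laws o1 A mA).
- exact: (laws o2 A mA).
Qed.

Lemma M3_M2 mu1 mu2 mu3 (Q : probability T3 R) : M3 mu1 mu2 mu3 Q ->
  exists2 Q' : probability (R * R)%type R, M2 mu1 mu3 Q' &
    forall f : R * R -> R, measurable_fun setT f ->
      \int[Q']_w (f w)%:E = \int[Q]_w (f (w.1.1, w.2))%:E.
Proof.
move=> [laws mart].
have mphi : measurable_fun setT (fun w : T3 => (w.1.1, w.2)).
  by apply: measurable_fun_pair; [exact: (measurable_canonical3 o0)|exact: (measurable_canonical3 o2)].
pose phi : {mfun T3 >-> (R * R)%type} := HB.pack (fun w : T3 => (w.1.1, w.2))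
  (isMeasurableFun.Build _ _ _ _ _ mphi).
exists (distribution Q phi).
  split.
    by elim/I2_ind => A mA; [exact: (laws o0 A mA)|exact: (laws o2 A mA)].
  apply: (@martingale_pushforward _ _ _ _ _ Q _ phi mphi _ 3 2
    (fun i : 'I_2 => if i == ord0 then o0 else o2) canonical3 canonical2 _ _ _ mart) => //.
  - by elim/I2_ind; elim/I2_ind.
  - exact: measurable_canonical2.
  - by elim/I2_ind.
move=> f mf.
have mf' : measurable_fun setT (fun w => (f w)%:E) by exact/measurable_EFinP.
have law (B : set (R * R)) : measurable B ->
  distribution Q phi (idfun @^-1` B) = Q (phi @^-1` B) by [].
exact: (integral_law (@measurable_id _ _ setT) mphi law mf').
Qed.

End CanonicalProcess.

Section Prices.
Local Open Scope ereal_scope.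
Context {R : realType} (c : R * R -> R) (mu1 mu3 : probability R R).
Hypothesis cc : continuous c.

Lemma lower_price2_le3 mu2 : lower_price2 c mu1 mu3 <= lower_price3 c mu1 mu2 mu3.
Proof.
apply: le_ereal_inf_tmp => _ [Q MQ <-].
have [Q' MQ' E] := M3_M2 MQ.
apply: ereal_inf_lbound; exists Q' => //.
by rewrite !unlock; apply: E; exact: continuous_measurable_fun2.
Qed.

(** Prices are extended reals, so the separating level has to be found for infinite values too. *)
Lemma lt_real_between (x y : \bar R) : x < y -> exists r : R, x < r%:E /\ r%:E < y.
Proof.
case: x y => [x| |] [y| |] //.
- by rewrite lte_fin => xy; exists ((x + y) / 2)%R; rewrite !lte_fin; split; lra.
- by move=> _; exists (x + 1)%R; rewrite lte_fin ltry; split => //; lra.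
- by move=> _; exists (y - 1)%R; rewrite lte_fin ltNyr; split => //; lra.
- by move=> _; exists 0%R; rewrite ltNyr ltry.
Qed.

(** One inequality always holds by [lower_price2_le3]; the other is restated with real levels r, for
    which the existence of a law is stable under limits and mixtures. *)
Lemma lower_price_eqP mu2 :
  lower_price3 c mu1 mu2 mu3 = lower_price2 c mu1 mu3 <->
  forall r : R, lower_price2 c mu1 mu3 < r%:E ->
    exists2 Q, M3 mu1 mu2 mu3 Q & \int[Q]_w (c (w.1.1, w.2))%:E <= r%:E.
Proof.
split=> [E r|H].
  rewrite -E => /ereal_inf_lt[_ [Q MQ <-]] /ltW; rewrite unlock => h.
  by exists Q.
apply/eqP; rewrite eq_le lower_price2_le3 andbT leNgt; apply/negP.
move=> /lt_real_between[r [r2 r3]]; have [Q MQ Qr] := H r r2.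
have : lower_price3 c mu1 mu2 mu3 <= r%:E.
  by apply: le_trans Qr; apply: ereal_inf_lbound; exists Q => //; rewrite unlock.
by rewrite leNgt r3.
Qed.

End Prices.

Section LinearGrowth.
Local Open Scope ereal_scope.
Context {R : realType}.

Lemma C_lin2_growth (c : R * R -> R) : C_lin2 c ->
  exists2 K : R, (0 <= K)%R & forall x, (`|c x| <= K * (1 + (`|x.1| + `|x.2|)))%R.
Proof.
move=> [_]; pose S := range (fun x : R * R =>
  (`|c x| / (1 + (`|x.1| + `|x.2|)))%:E); rewrite -/S => Soo.
have le x : (`|c x| / (1 + (`|x.1| + `|x.2|)))%:E <= ereal_sup S.
  by apply: ereal_sup_ubound; exists x.
have d0 x : (0 < 1 + (`|x.1| + `|x.2|) :> R)%R.
  by rewrite (@lt_le_trans _ _ 1%R)// lerDl addr_ge0.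
move: le Soo; case: (ereal_sup S) => [K| |] le // _; last first.
  by have := le (0%R, 0%R); rewrite leeNy_eq.
exists K.
  have := le (0%R, 0%R); rewrite lee_fin; apply: le_trans.
  by rewrite divr_ge0// ltW.
by move=> x; have := le x; rewrite lee_fin ler_pdivrMr.
Qed.

End LinearGrowth.

Section Couplings.
Local Open Scope ereal_scope.
Context {R : realType} (mu nu : probability R R) (P : probability (R * R)%type R).
Hypothesis cP : couplings mu nu P.

Let law1 B : measurable B -> P (fst @^-1` B) = mu (idfun @^-1` B).
Proof. by move=> mB; exact: cP.1. Qed.
Let law2 B : measurable B -> P (snd @^-1` B) = nu (idfun @^-1` B).
Proof. by move=> mB; exact: cP.2. Qed.

Lemma measurable_dist_pair :
  measurable_fun setT (fun w : R * R => (`|w.1 - w.2|%R)%:E).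
Proof.
apply/measurable_EFinP; apply: measurableT_comp => //.
by apply: measurable_funB; [exact: measurable_fst|exact: measurable_snd].
Qed.

(** From |x| <= |x - y| + |y|. This is how the limiting marginal inherits a finite first moment. *)
Lemma coupling_first_moment : \int[P]_w (`|w.1 - w.2|)%:E < +oo ->
  nu.-integrable setT (EFin \o (@idfun R)) ->
  mu.-integrable setT (EFin \o (@idfun R)).
Proof.
move=> Poo inu.
have mE := measurable_int _ inu.
apply: (integrable_law (@measurable_fst _ _ _ _) (@measurable_id _ _ setT) law1 mE).
have law2' B : measurable B -> nu (idfun @^-1` B) = P (snd @^-1` B).
  by move=> mB; rewrite law2.
have i2 := integrable_law (@measurable_id _ _ setT) (@measurable_snd _ _ _ _) law2' mE inu.
have i12 : P.-integrable setT (fun w => (`|w.1 - w.2|%R)%:E).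
  apply/integrableP; split; first exact: measurable_dist_pair.
  by under eq_integral do rewrite gee0_abs ?lee_fin//.
apply: (le_integrable _ _ _ (integrableD measurableT i12 (integrable_abse i2))) => //.
  by apply/measurable_EFinP; exact: measurable_fst.
move=> w _; rewrite /= lee_fin [leRHS]ger0_norm ?addr_ge0//.
by rewrite -{1}(subrK w.2 w.1) ler_normD.
Qed.

(** The easy half of Kantorovich-Rubinstein duality. *)
Lemma coupling_lip (f : R -> R) (k : R) : (0 <= k)%R ->
  measurable_fun setT f -> (forall x y, `|f x - f y| <= k * `|x - y|)%R ->
  mu.-integrable setT (EFin \o f) -> nu.-integrable setT (EFin \o f) ->
  `|\int[mu]_x (f x)%:E - \int[nu]_x (f x)%:E| <= k%:E * \int[P]_w (`|w.1 - w.2|)%:E.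
Proof.
move=> k0 mf fk imu inu.
have mE : measurable_fun setT (EFin \o f) by exact/measurable_EFinP.
have law1' B : measurable B -> mu (idfun @^-1` B) = P (fst @^-1` B).
  by move=> mB; rewrite law1.
have law2' B : measurable B -> nu (idfun @^-1` B) = P (snd @^-1` B).
  by move=> mB; rewrite law2.
have i1 := integrable_law (@measurable_id _ _ setT) (@measurable_fst _ _ _ _) law1' mE imu.
have i2 := integrable_law (@measurable_id _ _ setT) (@measurable_snd _ _ _ _) law2' mE inu.
have -> : \int[mu]_x (f x)%:E = \int[P]_w ((EFin \o f) \o fst) w.
  exact: (integral_law (@measurable_id _ _ setT) (@measurable_fst _ _ _ _) law1' mE).
have -> : \int[nu]_x (f x)%:E = \int[P]_w ((EFin \o f) \o snd) w.
  exact: (integral_law (@measurable_id _ _ setT) (@measurable_snd _ _ _ _) law2' mE).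
rewrite -integralB//.
have iB := integrableB measurableT i1 i2.
apply: (le_trans (le_abse_integral _ _ _)) => //; first exact: measurable_int iB.
rewrite -ge0_integralZl//; last exact: measurable_dist_pair.
apply: ge0_le_integral => //.
- by apply: measurableT_comp => //; exact: measurable_int iB.
- by apply: measurable_funeM; exact: measurable_dist_pair.
- by move=> w _; rewrite /= lee_fin.
Qed.

End Couplings.

(** * Compactness of the martingale laws *)

Section LipschitzIntegralLimit.
Local Open Scope ereal_scope.
Context {R : realType} (m : probability R R) (m_ : nat -> probability R R).
Variable Pi : nat -> probability (R * R)%type R.
Hypothesis cPi : forall n, couplings m (m_ n) (Pi n).
Hypothesis Pi_small : forall n,
  \int[Pi n]_w (`|w.1 - w.2|)%:E <= (n.+1%:R^-1)%:E.

Lemma lip_integral_cvg (f : R -> R) (k : R) : (0 <= k)%R ->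
  measurable_fun setT f -> (forall x y, `|f x - f y| <= k * `|x - y|)%R ->
  m.-integrable setT (EFin \o f) -> (forall n, (m_ n).-integrable setT (EFin \o f)) ->
  \int[m_ n]_x (f x)%:E @[n --> \oo] --> \int[m]_x (f x)%:E.
Proof.
move=> k0 mf fk im im_.
have fm : \int[m]_x (f x)%:E \is a fin_num by exact: integrable_fin_num im.
have fm_ n : \int[m_ n]_x (f x)%:E \is a fin_num by exact: integrable_fin_num (im_ n).
have dist n : (`|fine (\int[m]_x (f x)%:E) - fine (\int[m_ n]_x (f x)%:E)| <= k * n.+1%:R^-1)%R.
  rewrite -lee_fin -abse_EFin EFinB !fineK//.
  apply: (le_trans (coupling_lip (cPi n) k0 mf fk im (im_ n))).
  by rewrite EFinM lee_wpmul2l.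
rewrite -(fineK fm); apply: (cvg_trans (G := (fine (\int[m_ n]_x (f x)%:E))%:E @[n --> \oo])).
  by apply: near_eq_cvg; apply: nearW => n; rewrite fineK.
apply: cvg_EFin; first exact: nearW.
apply/cvgrPdist_lt => e e0.
have k1 : (0 < k + 1)%R by rewrite ltr_wpDl.
have e1 : (0 < e / (k + 1))%R by rewrite divr_gt0.
apply: filterS (near_infty_natSinv_lt (PosNum e1)) => n /= ne.
apply: (le_lt_trans (dist n)).
rewrite (@le_lt_trans _ _ ((k + 1) * n.+1%:R^-1)%R)//.
  by rewrite ler_wpM2r ?invr_ge0// lerDl.
by rewrite mulrC -ltr_pdivlMr.
Qed.

End LipschitzIntegralLimit.

Section LinearGrowthIntegral.
Local Open Scope ereal_scope.
Context {R : realType}.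
Local Notation T3 := (R * R * R)%type.

(** The common dominating function for the cost and for the martingale tests; the latter involve the
    middle coordinate. *)
Definition growth (K : R) (w : T3) : R :=
  K * (1 + (`|w.1.1| + `|w.1.2| + `|w.2|)).

Lemma measurable_growth K : measurable_fun setT (growth K).
Proof.
have mn i : measurable_fun setT (fun w : T3 => `|canonical3 i w|%R).
  by apply: measurableT_comp => //; exact: measurable_canonical3.
apply: measurable_funM; first exact: measurable_cst.
apply: measurable_funD; first exact: measurable_cst.
exact: (measurable_funD (measurable_funD (mn o0) (mn o1)) (mn o2)).
Qed.

Lemma growth_integral (Q : probability T3 R) K : (0 <= K)%R ->
  (forall i, Q.-integrable setT (EFin \o canonical3 i)) ->
  Q.-integrable setT (EFin \o growth K) /\
  \int[Q]_w (growth K w)%:E = K%:E * (1 + (\int[Q]_w (`|w.1.1|)%:E +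
    \int[Q]_w (`|w.1.2|)%:E + \int[Q]_w (`|w.2|)%:E)).
Proof.
move=> K0 iX.
have i0 : Q.-integrable setT (fun w : T3 => (`|w.1.1|)%:E) := integrable_abse (iX o0).
have i1 : Q.-integrable setT (fun w : T3 => (`|w.1.2|)%:E) := integrable_abse (iX o1).
have i2 : Q.-integrable setT (fun w : T3 => (`|w.2|)%:E) := integrable_abse (iX o2).
have i01 := integrableD measurableT i0 i1.
have i012 := integrableD measurableT i01 i2.
have ic := finite_measure_integrable_cst Q 1 measurableT.
have iS := integrableD measurableT ic i012.
split; first exact: (integrableZl measurableT K iS).
transitivity (\int[Q]_w (K%:E * (((EFin \o cst 1%R) \+ (((fun w : T3 => (`|w.1.1|)%:E) \+
  (fun w : T3 => (`|w.1.2|)%:E)) \+ (fun w : T3 => (`|w.2|)%:E))) w))).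
  by apply: eq_integral.
rewrite (integralZl measurableT iS) (integralD measurableT ic i012).
rewrite (integralD measurableT i01 i2) (integralD measurableT i0 i1).
have -> // : \int[Q]_x (EFin \o cst 1%R) x = 1.
by rewrite -[LHS]/(\int[Q]_x (cst 1 x)) integral_cst// mul1e; exact: probability_setT.
Qed.

End LinearGrowthIntegral.

Section Compactness.
Local Open Scope ereal_scope.
Context {R : realType} (mu1 mu3 m : probability R R) (m_ : nat -> probability R R).
Local Notation T3 := (R * R * R)%type.
Local Notation U := (measurableTypeR R).
Variables (Q : nat -> probability T3 R) (Pi : nat -> probability (R * R)%type R).
Hypothesis MQ : forall n, M3 mu1 (m_ n) mu3 (Q n).
Hypothesis cPi : forall n, couplings m (m_ n) (Pi n).
Hypothesis Pi_small : forall n,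
  \int[Pi n]_w (`|w.1 - w.2|)%:E <= (n.+1%:R^-1)%:E.

Let marg (a : probability R R) (j : nat) : probability R R :=
  if j is j'.+1 then if j' is _.+1 then mu3 else a else mu1.

Let shrink3 (w : T3) : T3 := (shrink w.1.1, shrink w.1.2, shrink w.2).
Let unshrink3 (w : T3) : T3 := (unshrink w.1.1, unshrink w.1.2, unshrink w.2).

Let measurable3 (f : R -> R) : measurable_fun setT f ->
  measurable_fun setT (fun w : T3 => (f w.1.1, f w.1.2, f w.2)).
Proof.
move=> mf; apply: measurable_fun_pair; first apply: measurable_fun_pair.
- exact: (measurableT_comp mf (measurable_canonical3 o0)).
- exact: (measurableT_comp mf (measurable_canonical3 o1)).
- exact: (measurableT_comp mf (measurable_canonical3 o2)).
Qed.

Let integrable_id_marg a Q' i : M3 mu1 a mu3 Q' ->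
  (marg a i).-integrable setT (EFin \o (@idfun R)).
Proof.
move=> [laws [iX _]].
have mE : measurable_fun setT (EFin \o (@idfun R)) by apply/measurable_EFinP; exact: measurable_id.
have H (j : 'I_3) (b : probability R R) : has_law Q' (canonical3 j) b ->
    b.-integrable setT (EFin \o (@idfun R)).
  move=> lj; apply: (integrable_law (measurable_canonical3 j) (@measurable_id _ _ setT) _ mE (iX j)).
  by move=> B mB; exact: lj.
case: i => [|[|i]]; [exact: H (laws o0)|exact: H (laws o1)|exact: H (laws o2)].
Qed.

Let integrable_id_m : m.-integrable setT (EFin \o (@idfun R)).
Proof.
apply: (coupling_first_moment (cPi 0)).
  by apply: (le_lt_trans (Pi_small 0)); rewrite ltry.
exact: (integrable_id_marg 1 (MQ 0)).
Qed.

Let integrable_lip_test (a : probability R R) f : lip_test f ->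
  a.-integrable setT (EFin \o f).
Proof.
move=> tf; apply: (le_integrable _ _ _ (finite_measure_integrable_cst a 1 measurableT)) => //.
  by apply/measurable_EFinP; exact: measurable_lip_test.
by move=> x _; have /andP[? ?] := tf.1 x; rewrite /= lee_fin normr1 ger0_norm.
Qed.

(** The law [Q'] is that of the almost sure limit after undoing [shrink]. Continuity of F is
    required along sequences of coordinates, the form in which convergence is available; F will be
    the cost, a martingale test or its opposite. *)
Lemma M3_subsequence_limit : exists (k : nat -> nat) (Q' : probability T3 R),
  M3 mu1 m mu3 Q' /\
  forall (F : T3 -> R) (K r : R), measurable_fun setT F -> (0 <= K)%R ->
    (forall x y z x' y' z', x n @[n --> \oo] --> x' -> y n @[n --> \oo] --> y' ->
       z n @[n --> \oo] --> z' -> F (x n, y n, z n) @[n --> \oo] --> F (x', y', z')) ->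
    (forall w, `|F w| <= growth K w)%R ->
    (forall n, \int[Q (k n)]_w (F w)%:E <= r%:E) -> \int[Q']_w (F w)%:E <= r%:E.
Proof.
have msq3 := measurable3 (@measurable_shrink R).
have mus3 := measurable3 (@measurable_unshrink R).
have [|k [A [A' [kn mA mA' lawA cvA]]]] := @skorokhod_subsequence R _ T3 shrink3 Q msq3.
  have s01 (x : R) : (0 <= shrink x <= 1)%R.
    by have /andP[? ?] := shrink_itv x; rewrite !ltW.
  by move=> w [|[|j]]; exact: s01.
pose B j n (u : U) := coord3 (A n u) j; pose B' j (u : U) := coord3 (A' u) j.
have mB j n : measurable_fun setT (B j n) := measurableT_comp (measurable_coord3 j) (mA n).
have mB' j : measurable_fun setT (B' j) := measurableT_comp (measurable_coord3 j) mA'.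
have lawB j n S : measurable S ->
    unif01 (B j n @^-1` S) = marg (m_ (k n)) j (shrink @^-1` S).
  move=> mS.
  have mc : measurable ((fun w : T3 => coord3 w j) @^-1` S).
    by rewrite -[X in measurable X]setTI; exact: measurable_coord3.
  have ms : measurable (shrink @^-1` S).
    by rewrite -[X in measurable X]setTI; exact: measurable_shrink.
  rewrite (lawA n _ mc); have [l0 l1 l2] := M3_law (MQ (k n)).
  by case: j mc => [|[|j]] mc; [exact: (l0 _ ms)|exact: (l1 _ ms)|exact: (l2 _ ms)].
have cvB j : {ae unif01, forall u, B j n u @[n --> \oo] --> B' j u}.
  apply: filterS cvA => u cu.
  have c1 : (A n u).1 @[n --> \oo] --> (A' u).1.
    by apply: (cvg_comp _ _ cu); exact: cvg_fst.
  rewrite /B /B'; case: j => [|[|j]] /=.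
  - by apply: (cvg_comp _ _ c1); exact: cvg_fst.
  - by apply: (cvg_comp _ _ c1); exact: cvg_snd.
  - by apply: (cvg_comp _ _ cu); exact: cvg_snd.
have cPik n : couplings m (m_ (k n)) (Pi (k n)) by [].
(* The rate survives the extraction because n <= k n. *)
have Pik n : \int[Pi (k n)]_w (`|w.1 - w.2|)%:E <= (n.+1%:R^-1)%:E.
  by apply: (le_trans (Pi_small _)); rewrite lee_fin lef_pV2 ?posrE// ler_nat ltnS.
have cvmarg (f : R -> R) (kf : R) j : (0 <= kf)%R -> measurable_fun setT f ->
    (forall x y, `|f x - f y| <= kf * `|x - y|)%R ->
    m.-integrable setT (EFin \o f) ->
    (forall n, (m_ (k n)).-integrable setT (EFin \o f)) ->
    \int[marg (m_ (k n)) j]_x (f x)%:E @[n --> \oo] --> \int[marg m j]_x (f x)%:E.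
  move=> kf0 mf fk im im_; case: j => [|[|j]] /=; [exact: cvg_cst| |exact: cvg_cst].
  exact: (lip_integral_cvg cPik Pik kf0 mf fk im im_).
have cvtest j f : lip_test f ->
    \int[marg (m_ (k n)) j]_x (f x)%:E @[n --> \oo] --> \int[marg m j]_x (f x)%:E.
  move=> tf; have [_ [kf kf0 fk]] := tf.
  apply: (cvmarg f kf) => //; [exact: measurable_lip_test|exact: integrable_lip_test|].
  by move=> n; exact: integrable_lip_test.
pose W n (u : U) := unshrink3 (A n u); pose W' (u : U) := unshrink3 (A' u).
have mW n : measurable_fun setT (W n) := measurableT_comp mus3 (mA n).
have mW' : measurable_fun setT W' := measurableT_comp mus3 mA'.
have lawW n S : measurable S -> unif01 (W n @^-1` S) = Q (k n) (idfun @^-1` S).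
  move=> mS; have mu3S : measurable (unshrink3 @^-1` S).
    by rewrite -[X in measurable X]setTI; exact: mus3.
  rewrite (_ : W n @^-1` S = A n @^-1` (unshrink3 @^-1` S))// (lawA n _ mu3S).
  by congr (Q (k n) _); apply/seteqP; split => -[[x y] z]; rewrite /= /unshrink3 /= !shrinkK.
have limlaw j S : measurable S -> unif01 ((unshrink \o B' j) @^-1` S) = marg m j S.
  by apply: (unshrink_limit_law (mB j) (mB' j) (lawB j) (cvB j) (cvtest j)).
have cvX j : {ae unif01, forall u, unshrink (B j n u) @[n --> \oo] --> unshrink (B' j u)}.
  exact: (unshrink_limit_cvg (mB j) (mB' j) (lawB j) (cvB j) (cvtest j)).
pose W1' : {mfun U >-> T3} := HB.pack W' (isMeasurableFun.Build _ _ _ _ _ mW').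
pose Q' : probability T3 R := distribution unif01 W1'.
have lawW' S : measurable S -> unif01 (W' @^-1` S) = Q' (idfun @^-1` S) by [].
have laws' i : has_law Q' (canonical3 i) (tnth [tuple mu1; m; mu3] i).
  by elim/I3_ind: i => S mS; [exact: (limlaw 0%N)|exact: (limlaw 1%N)|exact: (limlaw 2%N)].
have iM i : (tnth [tuple mu1; m; mu3] i).-integrable setT (EFin \o (@idfun R)).
  elim/I3_ind: i; [|exact: integrable_id_m|].
  - exact: (integrable_id_marg 0 (MQ 0)).
  - exact: (integrable_id_marg 2 (MQ 0)).
have mid : measurable_fun setT (EFin \o (@idfun R)).
  by apply/measurable_EFinP; exact: measurable_id.
have iX' i : Q'.-integrable setT (EFin \o canonical3 i).
  apply: (integrable_law (@measurable_id _ _ setT) (measurable_canonical3 i) _ mid (iM i)).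
  by move=> S mS; exact/esym/laws'.
have iXn n i : (Q n).-integrable setT (EFin \o canonical3 i) by have [_ [+ _]] := MQ n; exact.
have normE (P : probability T3 R) i a : has_law P (canonical3 i) a ->
    \int[P]_w (`|canonical3 i w|)%:E = \int[a]_x (`|x|)%:E.
  move=> la; have mn : measurable_fun setT (fun x : R => (`|x|)%:E).
    by apply/measurable_EFinP; exact: normr_measurable.
  by apply: (integral_law (measurable_canonical3 i) (@measurable_id _ _ setT) _ mn).
have limit (F : T3 -> R) (K r : R) : measurable_fun setT F -> (0 <= K)%R ->
    (forall x y z x' y' z', x n @[n --> \oo] --> x' -> y n @[n --> \oo] --> y' ->
       z n @[n --> \oo] --> z' -> F (x n, y n, z n) @[n --> \oo] --> F (x', y', z')) ->
    (forall w, `|F w| <= growth K w)%R ->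
    (forall n, \int[Q (k n)]_w (F w)%:E <= r%:E) -> \int[Q']_w (F w)%:E <= r%:E.
  move=> mF K0 cF FK Fr.
  have mE (f : T3 -> R) : measurable_fun setT f -> measurable_fun setT (fun w => (f w)%:E).
    by move=> mf; exact/measurable_EFinP.
  have lawWn n S : measurable S -> Q (k n) (idfun @^-1` S) = unif01 (W n @^-1` S).
    by move=> mS; rewrite lawW.
  have lawWi S : measurable S -> Q' (idfun @^-1` S) = unif01 (W' @^-1` S) by [].
  have int_n n f : measurable_fun setT f ->
      \int[Q (k n)]_w (f w)%:E = \int[unif01]_u (f (W n u))%:E.
    move=> mf; exact: (integral_law (@measurable_id _ _ setT) (mW n) (lawWn n) (mE f mf)).
  have int_i f : measurable_fun setT f ->
      \int[Q']_w (f w)%:E = \int[unif01]_u (f (W' u))%:E.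
    move=> mf; exact: (integral_law (@measurable_id _ _ setT) mW' lawWi (mE f mf)).
  have mg := @measurable_growth R K.
  rewrite int_i//.
  apply: (fatou_pratt (F_ := fun n => F \o W n) (G_ := fun n => growth K \o W n)
    (G := growth K \o W')).
  - by move=> n; exact: (measurableT_comp mF (mW n)).
  - exact: (measurableT_comp mF mW').
  - move=> n; apply: (integrable_law (@measurable_id _ _ setT) (mW n) (lawWn n) (mE _ mg)).
    exact: (growth_integral K0 (iXn (k n))).1.
  - apply: (integrable_law (@measurable_id _ _ setT) mW' lawWi (mE _ mg)).
    exact: (growth_integral K0 iX').1.
  - by move=> n w; exact: FK.
  - by move=> w; exact: FK.
  - apply: filterS3 (cvX 0%N) (cvX 1%N) (cvX 2%N) => u c0 c1 c2.
    exact: cF c0 c1 c2.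
  - apply: filterS3 (cvX 0%N) (cvX 1%N) (cvX 2%N) => u c0 c1 c2.
    rewrite /growth /=; apply: cvgM; first exact: cvg_cst.
    apply: cvgD; first exact: cvg_cst.
    apply: cvgD; first apply: cvgD; apply: cvg_norm; [exact: c0|exact: c1|exact: c2].
  (* The integral of [growth] depends on the marginals only, and only the middle one moves; its
     first moment converges since the absolute value is 1-Lipschitz. *)
  - have E (P : probability T3 R) a : (forall i, has_law P (canonical3 i) (tnth [tuple mu1; a; mu3] i)) ->
        (forall i, P.-integrable setT (EFin \o canonical3 i)) ->
        \int[P]_w (growth K w)%:E = K%:E * (1 + (\int[mu1]_x (`|x|)%:E +
          \int[a]_x (`|x|)%:E + \int[mu3]_x (`|x|)%:E)).
      move=> la iP; rewrite (growth_integral K0 iP).2.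
      by rewrite -(normE P o0 _ (la o0)) -(normE P o1 _ (la o1)) -(normE P o2 _ (la o2)).
    have f1 : \int[mu1]_x (`|x|)%:E \is a fin_num.
      by have := integrable_fin_num measurableT (integrable_abse (iM o0)).
    have fm : \int[m]_x (`|x|)%:E \is a fin_num.
      by have := integrable_fin_num measurableT (integrable_abse (iM o1)).
    have f3 : \int[mu3]_x (`|x|)%:E \is a fin_num.
      by have := integrable_fin_num measurableT (integrable_abse (iM o2)).
    rewrite -[X in _ --> X]int_i// (E Q' m)//.
    rewrite (_ : (fun n => _) = fun n => K%:E * (1 + (\int[mu1]_x (`|x|)%:E +
          \int[m_ (k n)]_x (`|x|)%:E + \int[mu3]_x (`|x|)%:E))); last first.
      by apply/funext => n; rewrite -[LHS]int_n// (E _ (m_ (k n)))//; case: (MQ (k n)).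
    apply: cvgeZl => //; apply: cvgeD; [by []|exact: cvg_cst|].
    apply: cvgeD; [by rewrite fin_num_adde_defl| |exact: cvg_cst].
    apply: cvgeD; [by rewrite fin_num_adde_defr|exact: cvg_cst|].
    apply: (cvmarg (fun x => `|x|%R) 1%R 1%N) => //.
    + by move=> x y; rewrite mul1r ler_dist_dist.
    + exact: (integrable_abse (iM o1)).
    + by move=> n; exact: (integrable_abse (integrable_id_marg 1 (MQ (k n)))).
  - by move=> n; rewrite -[leLHS]int_n.
exists k, Q'; split; last exact: limit.
have tests0 (F : T3 -> R) : measurable_fun setT F ->
    (forall x y z x' y' z', x n @[n --> \oo] --> x' -> y n @[n --> \oo] --> y' ->
       z n @[n --> \oo] --> z' -> F (x n, y n, z n) @[n --> \oo] --> F (x', y', z')) ->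
    (forall w, `|F w| <= growth 1 w)%R ->
    (forall n, \int[Q (k n)]_w (F w)%:E = 0) -> \int[Q']_w (F w)%:E = 0.
  move=> mF cF FK F0.
  have iF (P : probability T3 R) : (forall i, P.-integrable setT (EFin \o canonical3 i)) ->
      P.-integrable setT (EFin \o F).
    move=> iP; apply: (le_integrable _ _ _ (growth_integral ler01 iP).1) => //.
      exact/measurable_EFinP.
    by move=> w _; rewrite /= lee_fin (le_trans (FK w))// ler_norm.
  apply/eqP; rewrite eq_le; apply/andP; split.
    by apply: (limit F 1%R 0%R) => // n; rewrite F0.
  have N (P : probability T3 R) : (forall i, P.-integrable setT (EFin \o canonical3 i)) ->
      \int[P]_w ((- F w)%R)%:E = - \int[P]_w (F w)%:E.
    by move=> iP; rewrite -integralN ?integrable_add_def//; exact: iF.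
  rewrite -oppe_le0 -N//; apply: (limit (fun w => (- F w)%R) 1%R 0%R) => //.
  - exact: measurable_funN.
  - by move=> x y z x' y' z' cx cy cz; apply: cvgN; exact: cF.
  - by move=> w; rewrite normrN.
  - by move=> n; rewrite N// F0 oppe0.
have m0 : measurable_fun setT (fun w : T3 => w.1.1) := measurable_canonical3 o0.
have m1 : measurable_fun setT (fun w : T3 => w.1.2) := measurable_canonical3 o1.
have m2 : measurable_fun setT (fun w : T3 => w.2) := measurable_canonical3 o2.
(* Here c stands for the absolute value of the coordinate absent from the increment. *)
have bound (a b x y c : R) : (0 <= a <= 1)%R -> (0 <= b <= 1)%R -> (0 <= c)%R ->
    (`|(y - x) * (a * b)| <= 1 * (1 + (`|x| + `|y| + c)))%R.
  move=> /andP[a0 a1] /andP[b0 b1] c0; rewrite normrM (ger0_norm (mulr_ge0 a0 b0)).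
  rewrite (@le_trans _ _ `|y - x|)%R//; first by rewrite -[leRHS]mulr1 ler_wpM2l// mulr_ile1.
  by rewrite (le_trans (ler_normB _ _))//; lra.
split=> //; apply: martingale_canonical3 => // f g tf tg.
  apply: tests0 => [||w|n]; last exact: (M3_martingale_tests (MQ (k n)) tf tg).1.
  - apply: measurable_funM; first exact: measurable_funB.
    apply: measurable_funM; [exact: (measurableT_comp (measurable_lip_test tf) m0)|].
    exact: (measurableT_comp (measurable_lip_test tg) m0).
  - move=> x y z x' y' z' cx cy cz /=; apply: cvgM; first exact: cvgB.
    apply: cvgM; [apply: (cvg_comp _ _ cx)|apply: (cvg_comp _ _ cx)];
      exact: lip_test_continuous.
  - by apply: bound; [exact: tf.1|exact: tg.1|].
apply: tests0 => [||w|n]; last exact: (M3_martingale_tests (MQ (k n)) tf tg).2.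
- apply: measurable_funM; first exact: measurable_funB.
  apply: measurable_funM; [exact: (measurableT_comp (measurable_lip_test tf) m0)|].
  exact: (measurableT_comp (measurable_lip_test tg) m1).
- move=> x y z x' y' z' cx cy cz /=; apply: cvgM; first exact: cvgB.
  apply: cvgM; [apply: (cvg_comp _ _ cx)|apply: (cvg_comp _ _ cy)];
    exact: lip_test_continuous.
- rewrite /growth (_ : `|w.1.1| + `|w.1.2| + `|w.2| = `|w.1.2| + `|w.2| + `|w.1.1|)%R; last ring.
  by apply: bound; [exact: tf.1|exact: tg.1|].
Qed.

End Compactness.

(** * Closedness and convexity of the set of intermediate laws *)

Unset Implicit Arguments.

Theorem proposition2p4 (R : realType) (c : R * R -> R)
    (mu1 mu3 : probability R R) :
  C_lin2 c ->
  finite_first_moment mu1 -> finite_first_moment mu3 ->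
  convex_order mu1 mu3 ->
  closed [set m : convex_interval mu1 mu3 | set_I c mu1 mu3 (sval m)] /\
  convex_set_of_laws (set_I c mu1 mu3).
Proof.
move=> cC _ _ _; have cc := cC.1; have [K K0 cK] := C_lin2_growth cC.
have mc := continuous_measurable_fun2 cc.
have mc3 : measurable_fun setT (fun w : R * R * R => c (w.1.1, w.2)).
  apply: (measurableT_comp mc); apply: measurable_fun_pair.
    exact: (measurable_canonical3 o0).
  exact: (measurable_canonical3 o2).
have cgrowth (w : R * R * R) : `|c (w.1.1, w.2)| <= growth K w.
  apply: (le_trans (cK _)); rewrite /growth ler_wpM2l//= lerD2l.
  by rewrite -addrA lerD2l lerDr.
split.
- rewrite -openC.
  suff : W1_open (~` [set m : convex_interval mu1 mu3 | set_I c mu1 mu3 (sval m)]) by [].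
  move=> m nIm.
  apply: contrapT => nope; apply: nIm; case: m nope => m [m1m mm3] nope.
  split=> //=; apply/(lower_price_eqP _ _ cc) => r rP.
  (* If this failed for some n, the ball of radius 1 / (n + 1) around m would lie in the complement,
     against [nope]. *)
  have step n : exists m' : probability R R, exists Q Pi,
     [/\ M3 mu1 m' mu3 Q, (\int[Q]_w (c (w.1.1, w.2))%:E <= r%:E)%E,
         couplings m m' Pi & (\int[Pi]_w (`|w.1 - w.2|)%:E <= (n.+1%:R^-1)%:E)%E].
    apply: contrapT => no; apply: nope; exists n.+1%:R^-1 => [|m' Wm'] /=.
      by rewrite invr_gt0.
    move=> Im'; apply: no; exists (sval m').
    have [_ _ /(lower_price_eqP _ _ cc)/(_ r rP)[Q MQ Qr]] := Im'.
    have /ereal_inf_lt[_ [Pi cPi <-] /ltW Pilt] := Wm'.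
    by exists Q, Pi.
  have [m_ /choice[Q /choice[Pi H]]] := choice step.
  have MQ n : M3 mu1 (m_ n) mu3 (Q n) by case: (H n).
  have cPi n : couplings m (m_ n) (Pi n) by case: (H n).
  have sPi n : (\int[Pi n]_w (`|w.1 - w.2|)%:E <= (n.+1%:R^-1)%:E)%E by case: (H n).
  have [k [Q' [MQ' lim]]] := M3_subsequence_limit MQ cPi sPi.
  exists Q' => //; apply: (lim _ K) => //.
    move=> x y z x' y' z' cx _ cz /=.
    by apply: (cvg_comp _ _ (cvg_pair cx cz)); exact: cc.
  by move=> n; case: (H (k n)).
- move=> mu nu t [m1mu mum3 pmu] [m1nu num3 pnu]; split.
  + exact: convex_order_mixr.
  + exact: convex_order_mixl.
  apply/(lower_price_eqP _ _ cc) => r rP.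
  have [Q1 MQ1 Q1r] := (lower_price_eqP _ _ cc _).1 pmu r rP.
  have [Q2 MQ2 Q2r] := (lower_price_eqP _ _ cc _).1 pnu r rP.
  have ic Q a : M3 mu1 a mu3 Q -> Q.-integrable setT (fun w => (c (w.1.1, w.2))%:E).
    move=> [_ [iX _]].
    apply: (le_integrable _ _ _ (growth_integral K0 iX).1) => //; first exact/measurable_EFinP.
    by move=> w _; rewrite /= lee_fin (le_trans (cgrowth w))// ler_norm.
  (* The outer marginals of [Q1] and [Q2] agree, so mixing leaves them unchanged. *)
  have comb (x : \bar R) : x \is a fin_num ->
      ((t%:num)%:E * x + (1 - t%:num)%:E * x = x)%E.
    by move=> xf; rewrite -muleDl// -EFinD addrC subrK mul1e.
  exists (mixture_law t Q1 Q2).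
    split; last by apply: martingale_mixture; [case: MQ1|case: MQ2].
    move=> i A mA; apply: (etrans (mixture_lawE t Q1 Q2 _)).
    have e1 : Q1 (canonical3 i @^-1` A) = tnth [tuple mu1; mu; mu3] i A := MQ1.1 i A mA.
    have e2 : Q2 (canonical3 i @^-1` A) = tnth [tuple mu1; nu; mu3] i A := MQ2.1 i A mA.
    rewrite e1 e2; elim/I3_ind: i {e1 e2} => /=.
    * by apply: comb; exact: fin_num_measure.
    * exact/esym/mixtureE.
    * by apply: comb; exact: fin_num_measure.
  rewrite (integral_mixture_law _ measurableT (ic _ _ MQ1) (ic _ _ MQ2)).
  have -> : (r%:E = (t%:num)%:E * r%:E + (1 - t%:num)%:E * r%:E)%E.
    by rewrite -!EFinM -EFinD; congr EFin; ring.
  by apply: leeD; apply: lee_wpmul2l; rewrite ?lee_fin ?subr_ge0.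
Qed.
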